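(* Let $\mathbb{F}$ be a field of characteristic $\neq 2$ and let $L$ be a nilpotent Lie algebra over $\mathbb{F}$ with $\dim L\le 6$. Then $L$ is noncapable if and only if $L$ is isomorphic to one of the following Lie algebras: $A(1)$, $L_{5,4}$, $L_{6,4}$, $L_{6,10}$, $L_{6,14}$, $L_{6,16}$, $L_{6,19}(\varepsilon)$ for some $\varepsilon\in\mathbb{F}$, $L_{6,20}$.
   Context: A Lie algebra $L$ is called capable if $L\cong E/Z(E)$ for some Lie algebra $E$, where $Z(E)$ is the center of $E$; otherwise it is noncapable. $A(n)$ denotes the abelian Lie algebra of dimension $n$. For $m\ge 1$, $H(m)$ denotes the Heisenberg Lie algebra of dimension $2m+1$, with basis $x_1,\dots,x_{2m},x$ and nonzero brackets $[x_{2i-1},x_{2i}]=x$ ($1\le i\le m$). The following Lie algebras over $\mathbb{F}$ are used. Those given by brackets have basis $x_1,\dots,x_6$, and all brackets of basis elements not listed (up to antisymmetry) are zero. - $L_{5,4}=H(2)$ and $L_{6,4}=H(2)\oplus A(1)$. - $L_{6,10}$: $[x_1,x_2]=x_3$, $[x_1,x_3]=x_6$, $[x_4,x_5]=x_6$. - $L_{6,14}$: $[x_1,x_2]=x_3$, $[x_1,x_3]=x_4$, $[x_1,x_4]=x_5$, $[x_2,x_3]=x_5$, $[x_2,x_5]=x_6$, $[x_3,x_4]=-x_6$. - $L_{6,16}$: $[x_1,x_2]=x_3$, $[x_1,x_3]=x_4$, $[x_1,x_4]=x_5$, $[x_2,x_5]=x_6$, $[x_3,x_4]=-x_6$. - $L_{6,19}(\varepsilon)$,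 $\varepsilon\in\mathbb{F}$: $[x_1,x_2]=x_4$, $[x_1,x_3]=x_5$, $[x_1,x_5]=x_6$, $[x_2,x_4]=x_6$, $[x_3,x_5]=\varepsilon x_6$. - $L_{6,20}$: $[x_1,x_2]=x_4$, $[x_1,x_3]=x_5$, $[x_1,x_5]=x_6$, $[x_2,x_4]=x_6$. *)

(* Defs.v *)
From HB Require Import structures.
From mathcomp Require Import all_boot all_order all_algebra.
From mathcomp Require Import generic_quotient ring_quotient ring boolp.

Set Implicit Arguments.
Unset Strict Implicit.
Unset Printing Implicit Defensive.

Import GRing.Theory.
Local Open Scope ring_scope.
Local Open Scope quotient_scope.

(* The dimension of a Lie algebra is arbitrary at this level. *)
HB.mixin Record Lmodule_isLie (F : fieldType) L of GRing.Lmodule F L := {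
  lie : L -> L -> L;
  lie_is_linearl : forall (a : F) x y z,
    lie (a *: x + y) z = a *: lie x z + lie y z;
  lie_is_linearr : forall (a : F) x y z,
    lie z (a *: x + y) = a *: lie z x + lie z y;
  liexx : forall x, lie x x = 0;
  lie_jacobi : forall x y z,
    lie x (lie y z) + lie y (lie z x) + lie z (lie x y) = 0
}.

#[short(type="lieAlgType")]
HB.structure Definition LieAlgebra (F : fieldType) :=
  {L of GRing.Lmodule F L & Lmodule_isLie F L}.

#[short(type="lieVectType")]
HB.structure Definition LieVector (F : fieldType) :=
  {L of LieAlgebra F L & Vector F L}.

Section LieTheory.
Variables (F : fieldType) (L : lieAlgType F).
Implicit Types x y z : L.

Lemma lie0r x : lie 0 x = 0.
Proof. by have := lie_is_linearl (-1) 0 0 x; rewrite !scaleN1r oppr0 addr0 addNr. Qed.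

Lemma lier0 x : lie x 0 = 0.
Proof. by have := lie_is_linearr (-1) 0 0 x; rewrite !scaleN1r oppr0 addr0 addNr. Qed.

Lemma lieBl x y z : lie (x - y) z = lie x z - lie y z.
Proof. by rewrite addrC -scaleN1r lie_is_linearl scaleN1r addrC. Qed.

Lemma lieBr x y z : lie z (x - y) = lie z x - lie z y.
Proof. by rewrite addrC -scaleN1r lie_is_linearr scaleN1r addrC. Qed.

Lemma lieDl x y z : lie (x + y) z = lie x z + lie y z.
Proof. by rewrite -[x]scale1r lie_is_linearl !scale1r. Qed.

Lemma lieDr x y z : lie z (x + y) = lie z x + lie z y.
Proof. by rewrite -[x]scale1r lie_is_linearr !scale1r. Qed.

Lemma lieZl (a : F) x z : lie (a *: x) z = a *: lie x z.
Proof. by rewrite -[a *: x]addr0 lie_is_linearl lie0r addr0. Qed.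

Lemma lieZr (a : F) x z : lie z (a *: x) = a *: lie z x.
Proof. by rewrite -[a *: x]addr0 lie_is_linearr lier0 addr0. Qed.

Lemma lieC x y : lie x y = - lie y x.
Proof.
apply/eqP; rewrite -addr_eq0; apply/eqP.
by have := liexx (x + y); rewrite lieDl !lieDr !liexx add0r addr0.
Qed.

End LieTheory.

Definition lie_isomorphic (F : fieldType) (L M : lieAlgType F) : Prop :=
  exists f : {linear L -> M},
    bijective f /\ forall x y : L, f (lie x y) = lie (f x) (f y).

Section CenterQuotient.
Variables (F : fieldType) (E : lieAlgType F).

Definition lie_center : {pred E} := fun z => `[< forall x : E, lie z x = 0 >].

Lemma lie_centerP z : reflect (forall x : E, lie z x = 0) (z \in lie_center).
Proof. exact: asboolP. Qed.

Lemma lie_center_zmod_closed : zmod_closed lie_center.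
Proof.
split=> [|x y /lie_centerP zx /lie_centerP zy].
  by apply/lie_centerP=> x; exact: lie0r.
by apply/lie_centerP=> t; rewrite lieBl zx zy subrr.
Qed.

HB.instance Definition _ :=
  GRing.isZmodClosed.Build E lie_center lie_center_zmod_closed.

Definition center_quot : Type := Quotient.quot lie_center.

HB.instance Definition _ := GRing.Zmodule.copy center_quot
  (Quotient.quot lie_center).
HB.instance Definition _ := EqQuotient.copy center_quot
  (Quotient.quot lie_center).

Local Notation pi := (\pi_center_quot : E -> center_quot).

Lemma pi_center_eq (x y : E) : pi x = pi y <-> x - y \in lie_center.
Proof.
rewrite Quotient.idealrBE; split=> [xy|/eqP//].
by apply/eqP.
Qed.

Lemma pi_centerD (x y : E) : pi (x + y) = pi x + pi y.
Proof. exact: (Quotient.pi_add lie_center). Qed.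

Definition center_quot_scale (a : F) (u : center_quot) : center_quot :=
  pi (a *: repr u).
Definition center_quot_lie (u v : center_quot) : center_quot :=
  pi (lie (repr u) (repr v)).

Lemma repr_pi_center (x : E) : repr (pi x) - x \in lie_center.
Proof. by apply/pi_center_eq; rewrite reprK. Qed.

Lemma pi_center_scale (a : F) (x : E) : pi (a *: x) = center_quot_scale a (pi x).
Proof.
apply/esym/pi_center_eq; rewrite -scalerBr; apply/lie_centerP=> t.
by rewrite lieZl (lie_centerP _ (repr_pi_center x)) scaler0.
Qed.

Lemma pi_center_lie (x y : E) : pi (lie x y) = center_quot_lie (pi x) (pi y).
Proof.
congr (pi _).
have /lie_centerP zx := repr_pi_center x.
have /lie_centerP zy := repr_pi_center y.
have /subr0_eq -> : lie (repr (pi x)) (repr (pi y)) - lie x (repr (pi y)) = 0.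
  by rewrite -lieBl zx.
by apply/esym/subr0_eq; rewrite -lieBr lieC zy oppr0.
Qed.

Lemma center_quot_scaleA a b (u : center_quot) :
  center_quot_scale a (center_quot_scale b u) = center_quot_scale (a * b) u.
Proof.
by rewrite -[u]reprK -(pi_center_scale b) -2!pi_center_scale scalerA.
Qed.

Lemma center_quot_scale1 : left_id 1 center_quot_scale.
Proof. by move=> u; rewrite -[u]reprK -pi_center_scale scale1r. Qed.

Lemma center_quot_scaleDr : right_distributive center_quot_scale +%R.
Proof.
move=> a u v; rewrite -[u]reprK -[v]reprK.
by rewrite -pi_centerD -!pi_center_scale -pi_centerD scalerDr.
Qed.

Lemma center_quot_scaleDl u :
  {morph center_quot_scale^~ u : a b / a + b >-> a + b}.
Proof.
by move=> a b; rewrite -[u]reprK -!pi_center_scale -pi_centerD scalerDl.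
Qed.

HB.instance Definition _ := GRing.Zmodule_isLmodule.Build F center_quot
  center_quot_scaleA center_quot_scale1 center_quot_scaleDr center_quot_scaleDl.

Lemma pi_centerZ (a : F) (x : E) : pi (a *: x) = a *: pi x.
Proof. exact: pi_center_scale. Qed.

Lemma center_quot_lie_linearl a (u v w : center_quot) :
  center_quot_lie (a *: u + v) w =
  a *: center_quot_lie u w + center_quot_lie v w.
Proof.
rewrite -[u]reprK -[v]reprK -[w]reprK -pi_centerZ -pi_centerD -!pi_center_lie.
by rewrite -pi_centerZ -pi_centerD lie_is_linearl.
Qed.

Lemma center_quot_lie_linearr a (u v w : center_quot) :
  center_quot_lie w (a *: u + v) =
  a *: center_quot_lie w u + center_quot_lie w v.
Proof.
rewrite -[u]reprK -[v]reprK -[w]reprK -pi_centerZ -pi_centerD -!pi_center_lie.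
by rewrite -pi_centerZ -pi_centerD lie_is_linearr.
Qed.

Lemma pi_center0 : pi 0 = 0.
Proof. by rewrite -(scale0r 0) pi_centerZ scale0r. Qed.

Lemma center_quot_liexx (u : center_quot) : center_quot_lie u u = 0.
Proof. by rewrite -[u]reprK -pi_center_lie liexx pi_center0. Qed.

Lemma center_quot_jacobi (u v w : center_quot) :
  center_quot_lie u (center_quot_lie v w) +
  center_quot_lie v (center_quot_lie w u) +
  center_quot_lie w (center_quot_lie u v) = 0.
Proof.
have := congr1 pi (lie_jacobi (repr u) (repr v) (repr w)).
by rewrite !pi_centerD !pi_center_lie pi_center0 !reprK.
Qed.

HB.instance Definition _ := Lmodule_isLie.Build F center_quot
  center_quot_lie_linearl center_quot_lie_linearr
  center_quot_liexx center_quot_jacobi.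

End CenterQuotient.

Definition capable (F : fieldType) (L : lieAlgType F) : Prop :=
  exists E : lieAlgType F, lie_isomorphic L (center_quot E).

Section Nilpotent.
Variables (F : fieldType) (L : lieVectType F).

(* [U, V], the subspace spanned by the brackets lie u v, u in U, v in V;
   same pattern as prodv. *)
Definition liev (U V : {vspace L}) : {vspace L} :=
  <<[seq lie u v | u <- vbasis U, v <- vbasis V]>>%VS.

Lemma memv_lie (U V : {vspace L}) u v :
  u \in U -> v \in V -> lie u v \in liev U V.
Proof.
move=> /coord_vbasis-> /coord_vbasis->.
elim/big_rec: _ => [|i x _ IH]; first by rewrite lie0r mem0v.
rewrite lie_is_linearl memvD // memvZ //.
elim/big_rec: _ => [|j y _ IHj]; first by rewrite lier0 mem0v.
rewrite lie_is_linearr memvD // memvZ // memv_span //.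
by apply: allpairs_f; apply: mem_nth; rewrite size_tuple.
Qed.

Lemma lievP (U V W : {vspace L}) :
  reflect (forall u v, u \in U -> v \in V -> lie u v \in W) (liev U V <= W)%VS.
Proof.
apply: (iffP idP) => [/subvP sW u v uU vV|sW]; first exact/sW/memv_lie.
by apply/span_subvP=> _ /allpairsP[[u v] /= [uU vV ->]]; apply: sW;
  exact: vbasis_mem.
Qed.

Definition lower_central (n : nat) : {vspace L} := iter n (liev fullv) fullv.

Definition lie_nilpotent : Prop := exists n, lower_central n = 0%VS.

End Nilpotent.

Section DirectSum.
Variables (F : fieldType) (L M : lieAlgType F).

Definition prod_lie (x y : L * M) : L * M := (lie x.1 y.1, lie x.2 y.2).

Lemma prod_lie_linearl (a : F) x y z :
  prod_lie (a *: x + y) z = a *: prod_lie x z + prod_lie y z.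
Proof. by rewrite /prod_lie /= !lie_is_linearl. Qed.

Lemma prod_lie_linearr (a : F) x y z :
  prod_lie z (a *: x + y) = a *: prod_lie z x + prod_lie z y.
Proof. by rewrite /prod_lie /= !lie_is_linearr. Qed.

Lemma prod_liexx x : prod_lie x x = 0.
Proof. by rewrite /prod_lie !liexx. Qed.

Lemma prod_lie_jacobi x y z :
  prod_lie x (prod_lie y z) + prod_lie y (prod_lie z x) +
  prod_lie z (prod_lie x y) = 0.
Proof. by congr (_, _); exact: lie_jacobi. Qed.

HB.instance Definition _ := Lmodule_isLie.Build F (L * M)%type
  prod_lie_linearl prod_lie_linearr prod_liexx prod_lie_jacobi.

End DirectSum.

HB.instance Definition _ (F : fieldType) (L M : lieVectType F) :=
  LieAlgebra.copy (L * M)%type (L * M)%type.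

Section Tables.
Variables (F : fieldType) (n : nat).
Implicit Types (u v w : 'rV[F]_n) (t : seq (nat * nat * F * nat)).

(* The basis x_1, ..., x_n is numbered from 1: basisx k is x_k and coordx k u
   is the coefficient of x_k in u (both are 0 unless 1 <= k <= n). *)
Definition basisx (k : nat) : 'rV[F]_n := \row_j (j.+1 == k)%:R.
Definition coordx (k : nat) u : F := \sum_(j < n | j.+1 == k) u 0 j.

(* An entry (i, j, a, k) of t stands for [x_i, x_j] = a x_k (and hence
   [x_j, x_i] = - a x_k); the brackets not listed are 0. *)
Definition table_lie t u v : 'rV[F]_n :=
  \sum_(b <- t) let: (i, j, a, k) := b in
    (a * (coordx i u * coordx j v - coordx j u * coordx i v)) *: basisx k.

Lemma coordx_linear k (a : F) u v :
  coordx k (a *: u + v) = a * coordx k u + coordx k v.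
Proof.
by rewrite /coordx mulr_sumr -big_split; apply: eq_bigr => j _; rewrite !mxE.
Qed.

Lemma coordx0 k : coordx k 0 = 0.
Proof. by apply: big1 => j _; rewrite mxE. Qed.

Lemma coordx_ord (j : 'I_n) u : coordx j.+1 u = u 0 j.
Proof. by rewrite /coordx (big_pred1 j). Qed.

Lemma eq_coordx u v :
  (forall k, (0 < k <= n)%N -> coordx k u = coordx k v) -> u = v.
Proof.
by move=> uv; apply/rowP=> j; rewrite -!coordx_ord uv /=.
Qed.

Lemma coordxD k u v : coordx k (u + v) = coordx k u + coordx k v.
Proof. by rewrite -[u]scale1r coordx_linear mul1r scale1r. Qed.

Lemma coordx_basis k l : coordx k (basisx l) = ((k == l) && (0 < k <= n))%N%:R.
Proof.
case: (boolP (0 < k <= n)%N) => [|kn].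
  by case: k => // k kn; rewrite (coordx_ord (Ordinal kn)) mxE andbT.
rewrite andbF /coordx big1 // => j /eqP jk.
by case/negP: kn; rewrite -jk /=.
Qed.

Lemma coordx_lie t k u v : coordx k (table_lie t u v) =
  \sum_(b <- t) let: (i, j, a, l) := b in
    a * (coordx i u * coordx j v - coordx j u * coordx i v) *
      ((k == l) && (0 < k <= n))%N%:R.
Proof.
rewrite /table_lie; elim: t => [|[[[i j] a] l] t IH].
  by rewrite !big_nil coordx0.
by rewrite !big_cons coordx_linear IH coordx_basis.
Qed.

(* The same formula on coefficient functions; it computes. *)
Fixpoint coef_lie t (f g : nat -> F) (k : nat) : F :=
  if t is (i, j, a, l) :: t' then
    if (k == l) && (0 < k <= n)%N then
      a * (f i * g j - f j * g i) + coef_lie t' f g k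
    else coef_lie t' f g k
  else 0.

Lemma coordx_lieE t k u v :
  coordx k (table_lie t u v) = coef_lie t (coordx^~ u) (coordx^~ v) k.
Proof.
rewrite coordx_lie; elim: t => [|[[[i j] a] l] t IH]; first by rewrite big_nil.
rewrite big_cons IH /=; case: ifP => _; first by rewrite mulr1.
by rewrite mulr0 add0r.
Qed.

Definition table_jacobi t : Prop := forall u v w,
  table_lie t u (table_lie t v w) + table_lie t v (table_lie t w u) +
  table_lie t w (table_lie t u v) = 0.

Lemma coef_jacobi t :
    (forall (f g h : nat -> F) k, (0 < k <= n)%N ->
      coef_lie t f (coef_lie t g h) k + coef_lie t g (coef_lie t h f) k +
      coef_lie t h (coef_lie t f g) k = 0) ->
  table_jacobi t.
Proof.
have ext f f' g g' k : f =1 f' -> g =1 g' ->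
    coef_lie t f g k = coef_lie t f' g' k.
  move=> ff gg; elim: t => //= -[[[i j] a] l] t' ->.
  by rewrite !ff !gg.
move=> tJ u v w; apply: eq_coordx => k kn.
rewrite !coordxD coordx0 !coordx_lieE -[RHS](tJ (coordx^~ u) (coordx^~ v)
  (coordx^~ w) k kn).
by congr (_ + _ + _); apply: ext => // l; rewrite coordx_lieE.
Qed.

Record lie_table := LieTable {
  table_seq : seq (nat * nat * F * nat);
  table_seqP : table_jacobi table_seq
}.

Definition table_alg (T : lie_table) : Type := 'rV[F]_n.

Variable T : lie_table.
Local Notation br := (table_lie (table_seq T)).

Lemma table_lie_linearl (a : F) u v w : br (a *: u + v) w = a *: br u w + br v w.
Proof.
rewrite /table_lie scaler_sumr -big_split; apply: eq_bigr => -[[[i j] c] k] _ /=.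
by rewrite !coordx_linear scalerA -scalerDl; congr (_ *: _); ring.
Qed.

Lemma table_lie_linearr (a : F) u v w : br w (a *: u + v) = a *: br w u + br w v.
Proof.
rewrite /table_lie scaler_sumr -big_split; apply: eq_bigr => -[[[i j] c] k] _ /=.
by rewrite !coordx_linear scalerA -scalerDl; congr (_ *: _); ring.
Qed.

Lemma table_liexx u : br u u = 0.
Proof.
apply: big1 => -[[[i j] c] k] _.
by rewrite mulrC [X in _ - X]mulrC subrr mul0r scale0r.
Qed.

HB.instance Definition _ := Vector.copy (table_alg T) 'rV[F]_n.
HB.instance Definition _ := Lmodule_isLie.Build F (table_alg T)
  table_lie_linearl table_lie_linearr table_liexx (table_seqP T).

End Tables.

Ltac jacobi6 :=
  apply: coef_jacobi => f g h [|[|[|[|[|[|[|k]]]]]]] // _ /=; ring.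

Section Algebras.
Variable F : fieldType.

Lemma abelian_jacobi n : @table_jacobi F n [::].
Proof. by move=> u v w; rewrite /table_lie !big_nil !addr0. Qed.

Definition abelian_lie (n : nat) := table_alg (LieTable (@abelian_jacobi n)).

Definition heisenberg_table (m : nat) : seq (nat * nat * F * nat) :=
  [seq (i.*2.-1, i.*2, 1, m.*2.+1) | i <- iota 1 m].

Lemma heisenberg_jacobi m : @table_jacobi F m.*2.+1 (heisenberg_table m).
Proof.
have central u v w :
    @table_lie F m.*2.+1 (heisenberg_table m) u
      (table_lie (heisenberg_table m) v w) = 0.
  rewrite [LHS]/table_lie big_map big_seq big1 // => i.
  rewrite mem_iota add1n ltnS => /andP[i_gt0 im].
  have low k : (k <= m.*2)%N ->
      coordx k (@table_lie F m.*2.+1 (heisenberg_table m) v w) = 0.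
    move=> km; rewrite coordx_lie big_map big1 // => l _.
    by rewrite ltn_eqF ?mulr0.
  have im2 : (i.*2 <= m.*2)%N by rewrite leq_double.
  by rewrite !low ?(leq_trans (leq_pred _)) // !mulr0 subrr mulr0 scale0r.
by move=> u v w; rewrite !central !addr0.
Qed.

Definition heisenberg_lie (m : nat) := table_alg (LieTable (@heisenberg_jacobi m)).

Definition L5_4 := heisenberg_lie 2.
Definition L6_4 := (heisenberg_lie 2 * abelian_lie 1)%type.

Definition L6_10_table : seq (nat * nat * F * nat) :=
  [:: (1, 2, 1, 3); (1, 3, 1, 6); (4, 5, 1, 6)].

Lemma L6_10_jacobi : @table_jacobi F 6 L6_10_table.
Proof. by jacobi6. Qed.

Definition L6_10 := table_alg (LieTable L6_10_jacobi).

Definition L6_14_table : seq (nat * nat * F * nat) :=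
  [:: (1, 2, 1, 3); (1, 3, 1, 4); (1, 4, 1, 5); (2, 3, 1, 5); (2, 5, 1, 6);
      (3, 4, -1, 6)].

Lemma L6_14_jacobi : @table_jacobi F 6 L6_14_table.
Proof. by jacobi6. Qed.

Definition L6_14 := table_alg (LieTable L6_14_jacobi).

Definition L6_16_table : seq (nat * nat * F * nat) :=
  [:: (1, 2, 1, 3); (1, 3, 1, 4); (1, 4, 1, 5); (2, 5, 1, 6); (3, 4, -1, 6)].

Lemma L6_16_jacobi : @table_jacobi F 6 L6_16_table.
Proof. by jacobi6. Qed.

Definition L6_16 := table_alg (LieTable L6_16_jacobi).

Definition L6_19_table (eps : F) : seq (nat * nat * F * nat) :=
  [:: (1, 2, 1, 4); (1, 3, 1, 5); (1, 5, 1, 6); (2, 4, 1, 6); (3, 5, eps, 6)].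

Lemma L6_19_jacobi (eps : F) : @table_jacobi F 6 (L6_19_table eps).
Proof. by jacobi6. Qed.

Definition L6_19 (eps : F) := table_alg (LieTable (L6_19_jacobi eps)).

Definition L6_20_table : seq (nat * nat * F * nat) :=
  [:: (1, 2, 1, 4); (1, 3, 1, 5); (1, 5, 1, 6); (2, 4, 1, 6)].

Lemma L6_20_jacobi : @table_jacobi F 6 L6_20_table.
Proof. by jacobi6. Qed.

Definition L6_20 := table_alg (LieTable L6_20_jacobi).

End Algebras.

(* Main.v *)
(** Write [c_1, ..., c_n] for linear forms giving coordinates on [L] and
    [(d c)(u, v) = c [u, v]].  A quotient [E / Z(E) = L] yields an [E]-valued
    2-cocycle on [L] with trivial radical, and conversely all scalar 2-cocycles
    together define a central extension of [L]; so [L] is noncapable if and only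
    if some [z <> 0] is central and killed by every 2-cocycle.

    Nilpotency gives coordinates with [c_i z = 0] for [i < n], [c_n z <> 0] and
    [d c_k] a combination of the [c_i ^ c_j] with [i < j < k].  Put
    [theta = d c_n].  If [f] is closed and [f ^ theta = d beta] with [beta] in
    the exterior square of [c_1, ..., c_(n-1)], then [f ^ c_n + beta] is a
    cocycle, whose vanishing on [z] forces [f = 0].  Thus [f |-> f ^ theta] is
    injective from the closed forms of [K = L / z] to its third cohomology.  This
    is so restrictive that normalizing the coordinates of [K] (of dimension at
    most 5) one after the other leaves, apart from contradictions, exactly the
    algebras of the list: [K] abelian gives [A(1)], [L_{5,4}], [L_{6,4}];
    [K = H(1) + A(2)] gives [L_{6,10}]; [d c_4 = c_1 ^ c_2, d c_5 = c_1 ^ c_3]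
    gives [L_{6,19}] and [L_{6,20}]; and [d c_3 = c_1 ^ c_2,
    d c_4 = c_1 ^ c_3, d c_5 = c_1 ^ c_4 + b c_2 ^ c_3] gives [L_{6,16}] for
    [b = 0] and [L_{6,14}] for [b <> 0]. *)
Require Import Defs.
From HB Require Import structures.
From mathcomp Require Import all_boot all_order all_algebra.
From mathcomp Require Import generic_quotient boolp functions ring.

Set Implicit Arguments.
Unset Strict Implicit.
Unset Printing Implicit Defensive.
Import GRing.Theory.
Local Open Scope ring_scope.

(** * Capability and 2-cocycles *)

Section Cocycle.
Variables (F : fieldType) (L : lieAlgType F).

Record cocycle (V : lmodType F) (B : L -> L -> V) : Prop := Cocycle {
  cocycle_linl : forall w, linear (B^~ w);
  cocycle_linr : forall w, linear (B w);
  cocyclexx : forall u, B u u = 0;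
  cocycle_cyc : forall u v w, B (lie u v) w + B (lie v w) u + B (lie w u) v = 0
}.

Lemma cocycleC (V : lmodType F) (B : L -> L -> V) :
  cocycle B -> forall u v, B u v = - B v u.
Proof.
move=> Bc u v; apply/eqP; rewrite -addr_eq0; apply/eqP.
have := cocyclexx Bc (1 *: u + v).
by rewrite (cocycle_linl Bc) !(cocycle_linr Bc) !(cocyclexx Bc) !scale1r add0r addr0.
Qed.

Definition scalar_cocycle := {phi : L -> L -> F^o | cocycle phi}.

(** One central coordinate for each scalar cocycle, so that a central vector of this single
    extension is tested against all cocycles at once. The space of coordinates may be
    infinite-dimensional, which [capable] allows. *)
Definition cocycle_ext : Type := (L * (scalar_cocycle -> F^o))%type.

HB.instance Definition _ := GRing.Lmodule.copy cocycle_ext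
  (L * (scalar_cocycle -> F^o))%type.

Definition ext_lie (x y : cocycle_ext) : cocycle_ext :=
  (lie x.1 y.1, fun phi : scalar_cocycle => sval phi x.1 y.1).

Lemma ext_lie_linearl (a : F) (x y z : cocycle_ext) :
  ext_lie (a *: x + y) z = a *: ext_lie x z + ext_lie y z.
Proof.
apply/pair_equal_spec; split; first exact: lie_is_linearl.
by apply/funext => -[phi phic] /=; exact: (cocycle_linl phic).
Qed.

Lemma ext_lie_linearr (a : F) (x y z : cocycle_ext) :
  ext_lie z (a *: x + y) = a *: ext_lie z x + ext_lie z y.
Proof.
apply/pair_equal_spec; split; first exact: lie_is_linearr.
by apply/funext => -[phi phic] /=; exact: (cocycle_linr phic).
Qed.

Lemma ext_liexx (x : cocycle_ext) : ext_lie x x = 0.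
Proof.
apply/pair_equal_spec; split; first exact: liexx.
by apply/funext => -[phi phic] /=; exact: (cocyclexx phic).
Qed.

Lemma ext_lie_jacobi (x y z : cocycle_ext) :
  ext_lie x (ext_lie y z) + ext_lie y (ext_lie z x) + ext_lie z (ext_lie x y)
  = 0.
Proof.
apply/pair_equal_spec; split; first exact: lie_jacobi.
apply/funext => -[phi phic] /=.
rewrite /GRing.add /= /GRing.zero /=.
rewrite !(cocycleC phic _ (lie _ _)) -!opprD.
by rewrite (cocycle_cyc phic) oppr0.
Qed.

HB.instance Definition _ := Lmodule_isLie.Build F cocycle_ext
  ext_lie_linearl ext_lie_linearr ext_liexx ext_lie_jacobi.

Local Open Scope quotient_scope.
Local Notation pi E := (\pi_(center_quot E) : E -> center_quot E).

(** A pair [(z, t)] is central in [cocycle_ext] exactly when [z] is central in [L] and killed by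
    every scalar cocycle. The hypothesis then gives [z = 0], so the center is the second factor and
    the quotient by it is [L]. *)
Lemma capable_of_cocycles :
    (forall z : L, (forall phi : scalar_cocycle, sval phi z =1 fun=> 0) ->
      (forall x, lie z x = 0) -> z = 0) ->
  capable L.
Proof.
move=> sep; exists cocycle_ext.
pose f (x : L) : center_quot cocycle_ext := pi cocycle_ext (x, 0).
have flin : linear f.
  move=> a u v; rewrite /f -pi_centerZ -pi_centerD; congr (pi _ _).
  by apply/pair_equal_spec; split => //=; rewrite scaler0 addr0.
pose f' : {linear L -> center_quot cocycle_ext} :=
  HB.pack f (GRing.isLinear.Build F L _ _ f flin).
exists f'; split; last first.
  move=> x y; rewrite /= /f.
  change (pi cocycle_ext (lie x y, (0 : scalar_cocycle -> F^o)) =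
    center_quot_lie (pi cocycle_ext (x, 0)) (pi cocycle_ext (y, 0))).
  rewrite -pi_center_lie; apply/pi_center_eq/lie_centerP => t.
  apply/pair_equal_spec; split => /=; first by rewrite subrr lie0r.
  apply/funext => -[phi phic] /=; rewrite subrr.
  by have := cocycle_linl phic t.1 (-1) 0 0; rewrite scaler0 add0r scaleN1r addNr.
have injf : injective f'.
  move=> x y /pi_center_eq/lie_centerP xy; apply/subr0_eq/sep => [phi t|t].
    have := congr1 snd (xy (t, 0)) => /(congr1 (@^~ phi)) /=.
    by [].
  by have := congr1 fst (xy (t, 0)).
(* The inverse forgets the second component of a representative, which is central. *)
exists (fun u : center_quot cocycle_ext => (repr u).1).
  move=> x; apply: injf; rewrite /= /f; apply/pi_center_eq.
  apply/lie_centerP => t; apply/pair_equal_spec.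
  have /lie_centerP/(_ t) := repr_pi_center ((x, 0) : cocycle_ext).
  by move=> /pair_equal_spec[].
move=> u; rewrite /= /f -[RHS]reprK; apply/pi_center_eq/lie_centerP => t.
have -> : ((repr u).1, 0) - repr u = (0, - (repr u).2) :> cocycle_ext.
  by case: (repr u) => a b; apply/pair_equal_spec; split => /=; rewrite ?subrr ?sub0r.
apply/pair_equal_spec; split => /=; first exact: lie0r.
apply/funext => -[phi phic] /=.
by have := cocycle_linl phic t.1 (-1) 0 0; rewrite scaler0 add0r scaleN1r addNr.
Qed.

(** The bracket of [E] depends only on classes modulo the center, so it descends to an [E]-valued
    cocycle on [L]. An element of its radical lifts to a central element of [E], hence is 0. *)
Lemma cocycle_of_capable : capable L ->
  exists (V : lmodType F) (B : L -> L -> V),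
    cocycle B /\ forall u, B u =1 (fun=> 0) -> u = 0.
Proof.
move=> [E [f [[g fg gf] fM]]]; exists E.
exists (fun u v => lie (repr (f u)) (repr (f v))).
have lift (x y : E) t : pi E x = pi E y -> lie x t = lie y t.
  by move=> /pi_center_eq/lie_centerP/(_ t); rewrite lieBl => /subr0_eq.
have lin w : linear (fun u => lie (repr (f u)) (repr (f w))).
  move=> a u v; rewrite -lie_is_linearl; apply: lift.
  by rewrite reprK linearP pi_centerD pi_centerZ !reprK.
split; first split => //.
- by move=> w a u v; rewrite lieC lin opprD -scalerN -!lieC.
- by move=> u; exact: liexx.
- move=> u v w.
  have M x y t : lie (repr (f (lie x y))) t = lie (lie (repr (f x)) (repr (f y))) t.
    by apply: lift; rewrite reprK fM pi_center_lie !reprK.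
  rewrite !M !(lieC (lie _ _)) -!opprD [X in - X](_ : _ = 0) ?oppr0 //.
  rewrite -addrA addrC.
  exact: (lie_jacobi (repr (f u)) (repr (f v)) (repr (f w))).
move=> u Bu; rewrite -[u]fg -[0 in RHS]fg; congr (g _).
rewrite linear0 -[LHS]reprK -(pi_center0 E); apply/pi_center_eq.
rewrite subr0; apply/lie_centerP => x.
have := Bu (g (pi E x)); rewrite gf => Bx.
rewrite -[RHS]Bx lieC [RHS]lieC; congr (- _); apply: lift.
by rewrite reprK.
Qed.
End Cocycle.

Lemma lie_isomorphic_sym (F : fieldType) (L M : lieAlgType F) :
  lie_isomorphic L M -> lie_isomorphic M L.
Proof.
move=> [f [[g fg gf] fM]].
have glin : linear g by move=> a u v; rewrite -[u]gf -[v]gf -linearP !fg.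
pose g' : {linear M -> L} := HB.pack g (GRing.isLinear.Build F M L _ g glin).
exists g'; split; first by exists f.
by move=> x y; rewrite /= -[x]gf -[y]gf -fM !fg.
Qed.

Lemma lie_isomorphic_trans (F : fieldType) (L M N : lieAlgType F) :
  lie_isomorphic L M -> lie_isomorphic M N -> lie_isomorphic L N.
Proof.
move=> [f [fb fM]] [g [gb gM]]; exists (g \o f); split.
  exact: bij_comp.
by move=> x y; rewrite /= fM gM.
Qed.

Lemma capable_iso (F : fieldType) (L M : lieAlgType F) :
  lie_isomorphic L M -> capable L -> capable M.
Proof.
move=> /lie_isomorphic_sym ML [E LE]; exists E.
exact: lie_isomorphic_trans LE.
Qed.

Lemma noncapable_of_cocycles (F : fieldType) (L M : lieAlgType F) (z : M) :
    z != 0 ->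
    (forall (V : lmodType F) (B : M -> M -> V), cocycle B -> B z =1 fun=> 0) ->
  lie_isomorphic L M -> ~ capable L.
Proof.
move=> z0 Bz LM /(capable_iso LM) /cocycle_of_capable [V [B [Bc B0]]].
by case/eqP: z0; apply: B0; apply: Bz.
Qed.

(** * Noncapability of the listed algebras *)

Section TableCocycle.
Variables (F : fieldType) (n : nat) (T : lie_table F n) (V : lmodType F).
Variables (B : table_alg T -> table_alg T -> V) (Bc : cocycle B).
Implicit Types x : table_alg T.
Local Notation e k := (basisx F n k : table_alg T).

Lemma linear_eq0_on_basis (g : table_alg T -> V) : linear g ->
  (forall k, (0 < k <= n)%N -> g (e k) = 0) -> g =1 fun=> 0.
Proof.
move=> glin g0 x.
pose g' : {linear table_alg T -> V} := HB.pack g (GRing.isLinear.Build F _ V _ g glin).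
rewrite -[g x]/(g' x) (row_sum_delta x) linear_sum big1 // => j _.
have -> : delta_mx 0 j = basisx F n j.+1 by apply/rowP => k; rewrite !mxE eqSS.
by rewrite linearZ /= (g0 j.+1 (ltn_ord j)) scaler0.
Qed.

Lemma cocycleDl u v w : B (u + v) w = B u w + B v w.
Proof. by rewrite -[u]scale1r (cocycle_linl Bc) !scale1r. Qed.

Lemma cocycle0l w : B 0 w = 0.
Proof. by apply: (addIr (B 0 w)); rewrite -cocycleDl !add0r. Qed.

Lemma cocycleZl a u w : B (a *: u) w = a *: B u w.
Proof. by rewrite -[a *: u]addr0 (cocycle_linl Bc) cocycle0l addr0. Qed.

Lemma cocycleNl u w : B (- u) w = - B u w.
Proof. by rewrite -[- u]scaleN1r cocycleZl scaleN1r. Qed.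

Lemma table_cyc i j k : B (table_lie (table_seq T) (e i) (e j)) (e k) +
  B (table_lie (table_seq T) (e j) (e k)) (e i) +
  B (table_lie (table_seq T) (e k) (e i)) (e j) = 0.
Proof. exact: (cocycle_cyc Bc). Qed.

End TableCocycle.

Lemma basisx_neq0 (F : fieldType) n k : (0 < k <= n)%N -> basisx F n k != 0.
Proof.
move=> kn; apply/eqP => /(congr1 (coordx k)).
by rewrite coordx_basis coordx0 eqxx kn => /eqP; rewrite oner_eq0.
Qed.

(** Writes out the cocycle identity on the basis vectors [x_i, x_j, x_k], evaluating the brackets by
    the table. *)
Ltac table_cycle Bc i j k :=
  have := table_cyc Bc i j k;
  rewrite /table_lie /= ?big_cons ?big_nil !coordx_basis /=
    ?(mulr0, mulr1, mul0r, mul1r, subr0, sub0r, scale0r, add0r, addr0, scale1r,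
      scaleN1r, oppr0) ?(cocycleDl Bc, cocycleZl Bc, cocycle0l Bc, cocycleNl Bc, cocyclexx Bc,
      addr0, add0r, oppr0, scaler0).

Section NoncapableTables.
Variable F : fieldType.

Lemma abelian_lie1_cocycle (V : lmodType F)
    (B : abelian_lie F 1 -> abelian_lie F 1 -> V) :
  cocycle B -> B (basisx F 1 1) =1 fun=> 0.
Proof.
move=> Bc; apply: linear_eq0_on_basis (cocycle_linr Bc _) _.
by case=> [|[|k]] // _; exact: cocyclexx Bc _.
Qed.

(** Against [x_1, x_2] one writes [x_5 = [x_3, x_4]], against [x_3, x_4] one writes [x_5 =
    [x_1, x_2]]; the two other terms of the cocycle identity contain zero brackets. The other tables
    are treated by similar choices. *)
Lemma L5_4_cocycle (V : lmodType F) (B : L5_4 F -> L5_4 F -> V) :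
  cocycle B -> B (basisx F 5 5) =1 fun=> 0.
Proof.
move=> Bc; apply: linear_eq0_on_basis (cocycle_linr Bc _) _.
case=> [|[|[|[|[|[|k]]]]]] // _.
- by table_cycle Bc 3%N 4%N 1%N.
- by table_cycle Bc 3%N 4%N 2%N.
- by table_cycle Bc 1%N 2%N 3%N.
- by table_cycle Bc 1%N 2%N 4%N.
- exact: cocyclexx Bc _.
Qed.

Lemma L6_10_cocycle (V : lmodType F) (B : L6_10 F -> L6_10 F -> V) :
  cocycle B -> B (basisx F 6 6) =1 fun=> 0.
Proof.
move=> Bc; apply: linear_eq0_on_basis (cocycle_linr Bc _) _.
case=> [|[|[|[|[|[|[|k]]]]]]] // _.
- by table_cycle Bc 4%N 5%N 1%N.
- by table_cycle Bc 4%N 5%N 2%N.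
- by table_cycle Bc 4%N 5%N 3%N.
- by table_cycle Bc 1%N 3%N 4%N.
- by table_cycle Bc 1%N 3%N 5%N.
- exact: cocyclexx Bc _.
Qed.

Lemma oppr_eq0_inj (V : zmodType) (x : V) : - x = 0 -> x = 0.
Proof. by move/eqP; rewrite oppr_eq0 => /eqP. Qed.

Lemma two_neq0 : 2%N \notin [pchar F] -> (2 : F) != 0.
Proof. by rewrite inE. Qed.

Lemma double_eq0 (V : lmodType F) (x : V) :
  2%N \notin [pchar F] -> x + x = 0 -> x = 0.
Proof.
move=> /two_neq0 /negPf F2 /eqP.
by rewrite -mulr2n -scaler_nat scaler_eq0 F2 => /eqP.
Qed.

Lemma L6_14_cocycle (V : lmodType F) (B : L6_14 F -> L6_14 F -> V) :
  2%N \notin [pchar F] -> cocycle B -> B (basisx F 6 6) =1 fun=> 0.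
Proof.
move=> F2 Bc; apply: linear_eq0_on_basis (cocycle_linr Bc _) _.
case=> [|[|[|[|[|[|[|k]]]]]]] // _.
(* The two identities give [B x_6 x_1 = - B x_3 x_5] and [B x_6 x_1 = B x_3 x_5]; characteristic not
   2 enters here. *)
- table_cycle Bc 1%N 2%N 5%N; table_cycle Bc 1%N 3%N 4%N.
  rewrite (cocycleC Bc _ (basisx F 6 3)) opprK addrC => /eqP.
  rewrite subr_eq0 => /eqP->; exact: double_eq0.
- table_cycle Bc 2%N 3%N 4%N; table_cycle Bc 1%N 3%N 5%N.
  by rewrite (cocycleC Bc (basisx F 6 5)) => ->; rewrite oppr0 add0r => /oppr_eq0_inj.
- by table_cycle Bc 2%N 5%N 3%N.
- by table_cycle Bc 2%N 5%N 4%N.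
- by table_cycle Bc 3%N 4%N 5%N => /oppr_eq0_inj.
- exact: cocyclexx Bc _.
Qed.

Lemma L6_16_cocycle (V : lmodType F) (B : L6_16 F -> L6_16 F -> V) :
  2%N \notin [pchar F] -> cocycle B -> B (basisx F 6 6) =1 fun=> 0.
Proof.
move=> F2 Bc; apply: linear_eq0_on_basis (cocycle_linr Bc _) _.
case=> [|[|[|[|[|[|[|k]]]]]]] // _.
- table_cycle Bc 1%N 2%N 5%N; table_cycle Bc 1%N 3%N 4%N.
  rewrite (cocycleC Bc _ (basisx F 6 3)) opprK addrC => /eqP.
  rewrite subr_eq0 => /eqP->; exact: double_eq0.
- by table_cycle Bc 2%N 3%N 4%N => /oppr_eq0_inj.
- by table_cycle Bc 2%N 5%N 3%N.
- by table_cycle Bc 2%N 5%N 4%N.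
- by table_cycle Bc 3%N 4%N 5%N => /oppr_eq0_inj.
- exact: cocyclexx Bc _.
Qed.

Lemma L6_19_cocycle eps (V : lmodType F) (B : L6_19 eps -> L6_19 eps -> V) :
  cocycle B -> B (basisx F 6 6) =1 fun=> 0.
Proof.
move=> Bc.
(* Proved first because the identity for [x_3] below also contains [eps] times this value. *)
have B61 : B (basisx F 6 6) (basisx F 6 1) = 0 by table_cycle Bc 1%N 2%N 4%N.
apply: linear_eq0_on_basis (cocycle_linr Bc _) _.
case=> [|[|[|[|[|[|[|k]]]]]]] // _.
- table_cycle Bc 1%N 2%N 5%N; table_cycle Bc 1%N 3%N 4%N.
  by rewrite (cocycleC Bc (basisx F 6 5)) => /oppr_eq0_inj->; rewrite add0r => /oppr_eq0_inj.
- by table_cycle Bc 1%N 3%N 5%N; rewrite B61 scaler0 add0r => /oppr_eq0_inj.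
- by table_cycle Bc 1%N 5%N 4%N.
- by table_cycle Bc 2%N 4%N 5%N.
- exact: cocyclexx Bc _.
Qed.

Lemma L6_20_cocycle (V : lmodType F) (B : L6_20 F -> L6_20 F -> V) :
  cocycle B -> B (basisx F 6 6) =1 fun=> 0.
Proof.
move=> Bc; apply: linear_eq0_on_basis (cocycle_linr Bc _) _.
case=> [|[|[|[|[|[|[|k]]]]]]] // _.
- by table_cycle Bc 1%N 2%N 4%N.
- table_cycle Bc 1%N 2%N 5%N; table_cycle Bc 1%N 3%N 4%N.
  by rewrite (cocycleC Bc (basisx F 6 5)) => /oppr_eq0_inj->; rewrite add0r => /oppr_eq0_inj.
- by table_cycle Bc 1%N 3%N 5%N => /oppr_eq0_inj.
- by table_cycle Bc 1%N 5%N 4%N.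
- by table_cycle Bc 2%N 4%N 5%N.
- exact: cocyclexx Bc _.
Qed.

(** On the Heisenberg factor this is the result for [L5_4]. Against the abelian factor one uses [x_5
    = [x_1, x_2]], where [x_1] and [x_2] commute with that factor. *)
Lemma L6_4_cocycle (V : lmodType F) (B : L6_4 F -> L6_4 F -> V) :
  cocycle B -> B (basisx F 5 5 : L5_4 F, 0 : abelian_lie F 1) =1 fun=> 0.
Proof.
move=> Bc.
have B1c : cocycle (fun u v : L5_4 F =>
    B (u, 0 : abelian_lie F 1) (v, 0 : abelian_lie F 1)).
  have lin0 a (u v : L5_4 F) : (a *: u + v, 0 : abelian_lie F 1) = a *: (u, 0) + (v, 0).
    by apply/pair_equal_spec; rewrite /= scaler0 addr0.
  have lie0 (u v : L5_4 F) : (lie u v, 0 : abelian_lie F 1) = lie (u, 0 : abelian_lie F 1) (v, 0).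
    by apply/pair_equal_spec; split => //=; rewrite lie0r.
  split=> [w a u v|w a u v|u|u v w]; rewrite ?lin0 ?lie0.
  - exact: cocycle_linl Bc _ _ _ _.
  - exact: cocycle_linr Bc _ _ _ _.
  - exact: cocyclexx Bc _.
  - exact: cocycle_cyc Bc _ _ _.
case=> x a.
have -> : (x, a) = 1 *: (x, 0) + (0, a) :> L6_4 F.
  by apply/pair_equal_spec; split; rewrite /= scale1r (addr0, add0r).
rewrite (cocycle_linr Bc) scale1r (_ : B _ (x, 0) = 0); last exact: (L5_4_cocycle B1c x).
have := cocycle_cyc Bc (basisx F 5 1 : L5_4 F, 0 : abelian_lie F 1) (basisx F 5 2 : L5_4 F, 0) (0, a).
have -> : lie (basisx F 5 1 : L5_4 F, 0 : abelian_lie F 1) (basisx F 5 2 : L5_4 F, 0)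
    = (basisx F 5 5, 0).
  apply/pair_equal_spec; split => /=; last exact: lie0r.
  change (table_lie (heisenberg_table F 2) (basisx F 5 1) (basisx F 5 2) = basisx F 5 5).
  rewrite /table_lie /= !big_cons big_nil !coordx_basis /=.
  by rewrite !(mulr0, mulr1, subr0, scale0r, scale1r, addr0).
have -> : lie (basisx F 5 2 : L5_4 F, 0 : abelian_lie F 1) (0, a) = 0.
  by apply/pair_equal_spec; split; [exact: lier0 | exact: lie0r].
have -> : lie (0 : L5_4 F, a) (basisx F 5 1 : L5_4 F, 0 : abelian_lie F 1) = 0.
  by apply/pair_equal_spec; split; [exact: lie0r | exact: lier0].
rewrite add0r => <-.
have B0 w : B 0 w = 0.
  by have := cocycle_linl Bc w (-1) 0 0; rewrite scaler0 add0r scaleN1r addNr.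
by rewrite !B0 !addr0.
Qed.
End NoncapableTables.

(** * Coordinate forms *)

Section Forms.
Variables (F : fieldType) (L : lieVectType F).
Implicit Types (c f g : L -> F) (cs : seq (L -> F)).

(** Forms are plain functions with a linearity predicate, so that new coordinates can be written
    directly as explicit combinations of old ones. *)
Definition linform f : Prop := forall a u v, f (a *: u + v) = a * f u + f v.

Lemma form0 f : linform f -> f 0 = 0.
Proof. by move=> fl; have := fl (-1) 0 0; rewrite scaler0 addr0 mulN1r addNr. Qed.

Lemma formZ f : linform f -> forall a u, f (a *: u) = a * f u.
Proof. by move=> fl a u; rewrite -[a *: u]addr0 fl form0 ?addr0. Qed.

Lemma formB f : linform f -> forall u v, f (u - v) = f u - f v.
Proof. by move=> fl u v; rewrite addrC -scaleN1r fl mulN1r addrC. Qed.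

Lemma formD f : linform f -> forall u v, f (u + v) = f u + f v.
Proof. by move=> fl u v; rewrite -[u]scale1r fl mul1r scale1r. Qed.

(** A recursive conjunction, as is [vanish]: on an explicit list it unfolds into separate hypotheses
    on the forms. *)
Fixpoint all_form cs : Prop :=
  if cs is c :: cs' then linform c /\ all_form cs' else True.

Fixpoint vanish cs (u : L) : Prop :=
  if cs is c :: cs' then c u = 0 /\ vanish cs' u else True.

Lemma all_form_nth cs i : all_form cs -> linform (nth (fun=> 0) cs i).
Proof.
elim: cs i => [|c cs IH] [|i] /=; try by move=> _ a u v; rewrite mulr0 addr0.
  by case.
by case=> _; exact: IH.
Qed.

Lemma vanish_nth cs u : vanish cs u <-> forall i, nth (fun=> 0) cs i u = 0.
Proof.
elim: cs => [|c cs IH] /=; first by split=> // _ i; rewrite nth_nil.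
split=> [[cu /IH csu] [|i]|csu] //=.
by split; [exact: (csu 0) | apply/IH => i; exact: (csu i.+1)].
Qed.

Lemma vanish_lin cs a u v :
  all_form cs -> vanish cs u -> vanish cs v -> vanish cs (a *: u + v).
Proof.
elim: cs => //= c cs IH [cl csl] [cu csu] [cv csv]; split; last exact: IH.
by rewrite cl cu cv mulr0 addr0.
Qed.

(** A basis of the dual space: no common zero but 0, and the right number of forms. *)
Definition frame cs : Prop :=
  [/\ all_form cs, (forall u, vanish cs u -> u = 0) & size cs = \dim {:L}].

(** Linear independence in its dual form: all prescribed values are attained. *)
Definition free_forms cs : Prop :=
  forall vals, size vals = size cs -> exists e : L, [seq c e | c <- cs] = vals.

Lemma frame_free cs : frame cs -> free_forms cs.
Proof.
move=> [csl inj csn] vals sz.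
pose h (u : L) : 'rV[F]_(size cs) := \row_i nth (fun=> 0) cs i u.
have hl : linear h.
  by move=> a u v; apply/rowP => i; rewrite !mxE (all_form_nth _ csl).
pose h' : {linear L -> 'rV[F]_(size cs)} := HB.pack h (GRing.isLinear.Build F L _ _ h hl).
have kerh : lker (linfun h') = 0%VS.
  apply/eqP; rewrite -subv0; apply/subvP => u; rewrite memv_ker lfunE /= => /eqP hu.
  rewrite memv0; apply/eqP/inj/vanish_nth => i.
  case: (ltnP i (size cs)) => [ics|ics]; last by rewrite nth_default.
  by have := congr1 (fun w : 'rV_ _ => w 0 (Ordinal ics)) hu; rewrite !mxE.
have imh : limg (linfun h') = fullv.
  apply/eqP; rewrite eqEdim subvf /= limg_dim_eq ?kerh ?capv0 //.
  by rewrite -csn dimvf /dim /= mul1n.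
have : (\row_i nth 0 vals i : 'rV[F]_(size cs)) \in limg (linfun h').
  by rewrite imh memvf.
case/memv_imgP => e _; rewrite lfunE /= => eE; exists e.
apply: (@eq_from_nth _ 0) => [|i]; rewrite size_map // => ics.
rewrite (nth_map (fun=> 0)) //.
by have := congr1 (fun w : 'rV_ _ => w 0 (Ordinal ics)) eE; rewrite !mxE.
Qed.

Lemma free_forms_behead c cs : free_forms (c :: cs) -> free_forms cs.
Proof.
move=> fr vals sz; have [|e /= [_ eE]] := fr (0 :: vals); first by rewrite /= sz.
by exists e.
Qed.

Lemma free_forms_dual c cs : free_forms (c :: cs) ->
  exists e, c e = 1 /\ vanish cs e.
Proof.
move=> fr; have [|e /= [ce csE]] := fr (1 :: nseq (size cs) 0).
  by rewrite /= size_nseq.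
exists e; split=> //; elim: cs csE {fr} => //= c' cs IH [c'e csE].
by split=> //; exact: IH.
Qed.

Fixpoint lin (a : nat -> F) cs (u : L) : F :=
  if cs is c :: cs' then a 0%N * c u + lin (fun i => a i.+1) cs' u else 0.

(* [A i j] is the coefficient of [c_i ^ c_(i + j + 1)]. *)
Fixpoint quad (A : nat -> nat -> F) cs (u v : L) : F :=
  if cs is c :: cs' then
    c u * lin (A 0%N) cs' v - c v * lin (A 0%N) cs' u
    + quad (fun i => A i.+1) cs' u v
  else 0.

Lemma lin_form a cs : all_form cs -> linform (lin a cs).
Proof.
elim: cs a => [|c cs IH] a /=; first by move=> _ b u v; rewrite mulr0 addr0.
by move=> [cl csl] b u v; rewrite cl (IH _ csl); ring.
Qed.

Lemma quad_forml A cs v : all_form cs -> linform (quad A cs ^~ v).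
Proof.
elim: cs A => [|c cs IH] A /=; first by move=> _ b u w; rewrite mulr0 addr0.
by move=> [cl csl] b u w; rewrite cl (IH _ csl) (lin_form _ csl); ring.
Qed.

Lemma quadC A cs u v : quad A cs u v = - quad A cs v u.
Proof.
by elim: cs A => [|c cs IH] A /=; rewrite ?oppr0 // IH; ring.
Qed.

Lemma quadxx A cs u : quad A cs u u = 0.
Proof. by elim: cs A => [|c cs IH] A //=; rewrite IH; ring. Qed.

Lemma vanish_lin0 a cs u : vanish cs u -> lin a cs u = 0.
Proof. by elim: cs a => //= c cs IH a [-> /IH->]; rewrite mulr0 addr0. Qed.

Lemma vanish_quad0 A cs u v : vanish cs u -> quad A cs u v = 0.
Proof.
elim: cs A => //= c cs IH A [cu csu].
by rewrite cu IH // (vanish_lin0 _ csu) mul0r mulr0 subrr addr0.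
Qed.

(** With [e] dual to the first form [c], the form [u |-> g (u - c u *: e)] vanishes on the common
    zeros of the remaining forms, so induction applies to it; [g e] is the coefficient of [c]. *)
Lemma lin_expand cs g : all_form cs -> free_forms cs -> linform g ->
  (forall u, vanish cs u -> g u = 0) -> exists a, g =1 lin a cs.
Proof.
elim: cs g => [|c cs IH] g /=.
  by move=> _ _ gl g0; exists (fun=> 0) => u /=; exact: g0.
move=> [cl csl] fr gl g0; have [e [ce cse]] := free_forms_dual fr.
have [||a aE] := IH (fun u => g (u - c u *: e)) csl (free_forms_behead fr).
- move=> b u v; rewrite cl -gl; congr g.
  by rewrite scalerBr scalerA scalerDl opprD addrACA.
- move=> u csu; apply: g0; split.
    by rewrite formB // formZ // ce mulr1 subrr.
  by rewrite addrC -scaleNr; exact: vanish_lin.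
exists (fun i => if i is j.+1 then a j else g e) => u /=.
by rewrite -aE formB // formZ //; ring.
Qed.

(** Both arguments are split as [u = c u *: e + u']. The mixed terms [phi e v'] are expanded by
    [lin_expand], and [phi u' v'] by induction. *)
Lemma quad_expand cs (phi : L -> L -> F) : all_form cs -> free_forms cs ->
  (forall v, linform (phi^~ v)) -> (forall u v, phi u v = - phi v u) ->
  (forall u, phi u u = 0) ->
  (forall u v, vanish cs u -> phi u v = 0) ->
  exists A, forall u v, phi u v = quad A cs u v.
Proof.
elim: cs phi => [|c cs IH] phi /=.
  by move=> _ _ _ _ _ p0; exists (fun _ _ => 0) => u v /=; exact: p0.
move=> [cl csl] fr pl pC pxx p0; have [e [ce cse]] := free_forms_dual fr.
have pr v : linform (phi v) by move=> a u w; rewrite pC pl ![phi _ v]pC; ring.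
have lrest b u v : b *: u + v - c (b *: u + v) *: e
    = b *: (u - c u *: e) + (v - c v *: e).
  by rewrite cl scalerBr scalerA scalerDl opprD addrACA.
have csrest u : vanish cs u -> vanish (c :: cs) (u - c u *: e).
  move=> csu; split; first by rewrite formB // formZ // ce mulr1 subrr.
  by rewrite addrC -scaleNr; exact: vanish_lin.
have [||||A AE] := IH (fun u v => phi (u - c u *: e) (v - c v *: e)) csl
  (free_forms_behead fr).
- by move=> v b u w; rewrite lrest pl.
- by move=> u v; exact: pC.
- by move=> u; exact: pxx.
- by move=> u v csu; apply: p0; exact: csrest.
have [||a aE] := lin_expand (g := fun v => phi e (v - c v *: e)) csl
  (free_forms_behead fr).
- by move=> b u v; rewrite lrest pr.
- by move=> u csu; rewrite pC p0 ?oppr0 //; exact: csrest.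
exists (fun i => if i is j.+1 then A j else a) => u v /=.
rewrite -AE -!aE; set u' := u - _; set v' := v - _.
have -> : phi u v = phi (c u *: e + u') (c v *: e + v').
  by rewrite ![_ *: e + _]addrC !subrK.
by rewrite pl !pr pxx (pC u' e); ring.
Qed.

End Forms.

(** * Isomorphisms read off from coordinates, and coordinates adapted to [z] *)

Section Frames.
Variables (F : fieldType) (L : lieVectType F).
Implicit Types (c f g : L -> F) (cs r : seq (L -> F)) (z : L).

Lemma lie_iso_of_inj (M : lieVectType F) (f : {linear L -> M}) :
  (forall u, f u = 0 -> u = 0) -> \dim {:L} = \dim {:M} ->
  (forall u v, f (lie u v) = lie (f u) (f v)) -> lie_isomorphic L M.
Proof.
move=> inj dimE fM; exists f; split=> //.
have kerf : lker (linfun f) == 0%VS.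
  by rewrite -subv0; apply/subvP => u; rewrite memv_ker lfunE memv0 => /eqP/inj->.
have imf : limg (linfun f) = fullv.
  apply/eqP; rewrite eqEdim subvf /= limg_dim_eq ?dimE //.
  by rewrite (eqP kerf) capv0.
exists (linfun f)^-1%VF => u; first by rewrite -[f u]lfunE lker0_lfunK.
by rewrite -[LHS]lfunE limg_lfunVK // imf memvf.
Qed.

(** Numbered from 1 to agree with [coordx]; the value is 0 outside the range. *)
Definition coef_of cs u (k : nat) : F :=
  if k is i.+1 then nth (fun=> 0) cs i u else 0.

(** The forms need not make up a frame: [L6_4] is reached by two such maps, one for each factor. *)
Lemma table_morphism n (T : lie_table F n) cs : all_form cs -> size cs = n ->
    (forall k u v, (0 < k <= n)%N ->
      coef_of cs (lie u v) k =
      coef_lie n (table_seq T) (coef_of cs u) (coef_of cs v) k) ->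
  exists h : {linear L -> table_alg T},
    (forall u, h u = 0 -> vanish cs u) /\
    (forall u v, h (lie u v) = lie (h u) (h v)).
Proof.
move=> csl sz bracket.
pose h (u : L) : table_alg T := \row_(i < n) nth (fun=> 0) cs i u.
have hl : linear h.
  by move=> a u v; apply/rowP => i; rewrite !mxE (all_form_nth _ csl).
pose h' : {linear L -> table_alg T} :=
  HB.pack h (GRing.isLinear.Build F L (table_alg T) _ h hl).
have coefh u k : coordx k (h u) = coef_of cs u k.
  case: k => [|k]; first by rewrite /coordx big1.
  case: (ltnP k n) => [kn|nk].
    by rewrite (coordx_ord (Ordinal kn)) mxE.
  rewrite /= nth_default ?sz // /coordx big1 // => j /eqP[jk].
  by have := ltn_ord j; rewrite jk ltnNge nk.
exists h'; split=> [u hu|u v].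
  apply/vanish_nth => i.
  by rewrite -[LHS]/(coef_of cs u i.+1) -coefh (_ : h u = 0) ?coordx0.
apply: eq_coordx => k kn.
rewrite -[h' _]/(h _) coefh bracket // coordx_lieE.
have ext (t : seq (nat * nat * F * nat)) (p p' q q' : nat -> F) :
    p =1 p' -> q =1 q' -> coef_lie n t p q k = coef_lie n t p' q' k.
  by move=> pp qq; elim: t => //= -[[[i j] a] l] t' ->; rewrite !pp !qq.
by apply: ext => l; rewrite coefh.
Qed.

Lemma table_iso n (T : lie_table F n) cs : frame cs -> size cs = n ->
    (forall k u v, (0 < k <= n)%N ->
      coef_of cs (lie u v) k =
      coef_lie n (table_seq T) (coef_of cs u) (coef_of cs v) k) ->
  lie_isomorphic L (table_alg T).
Proof.
move=> [csl inj csn] sz /(table_morphism csl sz)[h [h0 hM]].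
apply: (@lie_iso_of_inj (table_alg T) h) hM; first by move=> u /h0/inj.
by rewrite -csn sz dimvf /dim /= mul1n.
Qed.

Lemma L6_4_iso c1 c2 c3 c4 c5 c6 :
    frame [:: c1; c2; c3; c4; c5; c6] ->
    (forall u v, c1 (lie u v) = 0) -> (forall u v, c2 (lie u v) = 0) ->
    (forall u v, c3 (lie u v) = 0) -> (forall u v, c4 (lie u v) = 0) ->
    (forall u v, c5 (lie u v) =
      c1 u * c2 v - c2 u * c1 v + (c3 u * c4 v - c4 u * c3 v)) ->
    (forall u v, c6 (lie u v) = 0) ->
  lie_isomorphic L (L6_4 F).
Proof.
move=> [[l1 [l2 [l3 [l4 [l5 [l6 _]]]]]] inj sz] d1 d2 d3 d4 d5 d6.
have [||h [h0 hM]] := @table_morphism _ (LieTable (@heisenberg_jacobi F 2))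
  [:: c1; c2; c3; c4; c5] _ erefl; first by do !split.
  by move=> [|[|[|[|[|[|k]]]]]] u v //= _; rewrite ?(d1, d2, d3, d4, d5); ring.
have [||g [g0 gM]] := @table_morphism _ (LieTable (@abelian_jacobi F 1))
  [:: c6] _ erefl; first by do !split.
  by move=> [|[|k]] u v //= _; rewrite d6.
pose hg u : L6_4 F := (h u, g u).
have hgl : linear hg.
  by move=> a u v; apply/pair_equal_spec; split; rewrite linearP.
pose hg' : {linear L -> L6_4 F} := HB.pack hg (GRing.isLinear.Build F L (L6_4 F) _ hg hgl).
apply: (@lie_iso_of_inj (L6_4 F) hg').
- move=> u /pair_equal_spec[/h0 /= [u1 [u2 [u3 [u4 [u5 _]]]]] /g0 /= [u6 _]].
  by apply: inj; do !split.
- by rewrite -sz dimvf.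
- by move=> u v; apply/pair_equal_spec; split; [exact: hM | exact: gM].
Qed.

Definition witness z : Prop :=
  (forall x, lie z x = 0) /\
  forall phi : L -> L -> F^o, cocycle phi -> phi z =1 fun=> 0.

Lemma noncapable_witness : ~ capable L -> exists z, z != 0 /\ witness z.
Proof.
move=> ncap; apply: contrapT => nwit; apply: ncap.
apply: capable_of_cocycles => z phiz zc; apply/eqP/negPn/negP => z0.
apply: nwit; exists z; split=> //; split=> // phi phic.
exact: (phiz (exist _ phi phic)).
Qed.

Lemma all_form_rcons cs c : all_form (rcons cs c) <-> all_form cs /\ linform c.
Proof. by elim: cs => [|c' cs IH] /=; [tauto | rewrite IH; tauto]. Qed.

Lemma vanish_rcons cs c u : vanish (rcons cs c) u <-> vanish cs u /\ c u = 0.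
Proof. by elim: cs => [|c' cs IH] /=; [tauto | rewrite IH; tauto]. Qed.

Lemma all_form_rev cs : all_form (rev cs) <-> all_form cs.
Proof.
by elim: cs => [|c cs IH] //=; rewrite rev_cons all_form_rcons IH; tauto.
Qed.

Lemma vanish_rev cs u : vanish (rev cs) u <-> vanish cs u.
Proof.
by elim: cs => [|c cs IH] //=; rewrite rev_cons vanish_rcons IH; tauto.
Qed.

(** The forms of [cs] are coordinates of [L / z], and [c] is a further coordinate that is nonzero on
    [z]. *)
Definition adapted z cs c : Prop :=
  [/\ frame (rcons cs c), vanish cs z & c z != 0].

(** The coordinates of [v - projv W v] vanish for [v] in [W], and one of them is nonzero at [u],
    which differs from its projection. *)
Lemma hyperplane_form (W : {vspace L}) u : u \notin W ->
  exists c, [/\ linform c, (forall w, w \in W -> c w = 0) & c u != 0].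
Proof.
move=> uW; pose p v := v - projv W v.
have pl a v w : p (a *: v + w) = a *: p v + p w.
  by rewrite /p linearP scalerBr opprD addrACA.
have pu : p u != 0.
  apply: contra uW; rewrite subr_eq0 => /eqP->; exact: memv_proj.
pose c i v := coord (vbasis {:L}) i (p v).
have [[i ci]|c0] := pselect (exists i, c i u != 0); last first.
  case/eqP: pu; rewrite (coord_vbasis (memvf (p u))) big1 // => i _.
  have /eqP ci : c i u == 0 by apply/negPn/negP => ci; apply: c0; exists i.
  by rewrite -[coord _ _ _]/(c i u) ci scale0r.
exists (c i); split=> //.
- by move=> a v w; rewrite /c pl linearP.
- by move=> w wW; rewrite /c /p projv_id // subrr linear0.
Qed.

(** Otherwise, [z] being central, the inclusion can be iterated: [J] lies in every term of the lower
    central series plus the line of [z], hence in that line by nilpotency. *)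
Lemma ideal_descent (J : {vspace L}) z : lie_nilpotent L -> z \in J ->
    (forall x, lie z x = 0) -> ~~ (J <= <[z]>)%VS ->
  ~~ (J <= liev fullv J + <[z]>)%VS.
Proof.
move=> [n Ln0] zJ zc; apply: contra => JW.
suff Jn k : (J <= lower_central L k + <[z]>)%VS by have := Jn n; rewrite Ln0 add0v.
elim: k => [|k IH]; first by rewrite (subv_trans (subvf _)) ?addvSl.
apply: subv_trans JW _; rewrite subv_add addvSr andbT.
apply/lievP => x y xJ /(subvP IH)/memv_addP[w wk [_ /vlineP[a ->] ->]].
rewrite lieDr lieZr (lieC x z) zc oppr0 scaler0 addr0.
by rewrite (subvP (addvSl _ _)) // memv_lie.
Qed.

(* The forms of [r] are listed from the last one to the first. *)
Fixpoint flag r : Prop :=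
  if r is c :: r' then
    (forall u v, vanish r' u -> c (lie u v) = 0) /\ flag r'
  else True.

(** Let [J] be the common kernel of the forms found so far. While [J] is larger than the line of
    [z], the next form is chosen to vanish on [[L, J] + <z>] but not on [J]; vanishing on [[L, J]]
    is the flag condition. *)
Lemma flag_exists z : lie_nilpotent L -> z != 0 -> (forall x, lie z x = 0) ->
  exists r c, flag r /\ adapted z (rev r) c.
Proof.
move=> nilL z0 zc.
suff extend m r (J : {vspace L}) : (\dim J <= m.+1)%N -> all_form r -> flag r ->
    vanish r z -> (forall u, u \in J <-> vanish r u) ->
    (\dim J + size r = \dim {:L})%N ->
  exists r' c, flag r' /\ adapted z (rev r') c.
  apply: (extend (\dim {:L}) [::] fullv) => //=.
  - by move=> u; rewrite memvf.
  - by rewrite addn0.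
elim: m r J => [|m IH] r J Jm rl rf rz Jr Jn; have zJ : z \in J by apply/Jr.
  all: have zJs : (<[z]> <= J)%VS by rewrite -memvE.
  all: case: (boolP (J <= <[z]>)%VS) => [Jz|].
  (* Once [J] is the line of [z], the flag is complete and any form nonzero at [z] serves as last
     coordinate. *)
  1,3: have [|c [cl _ cz]] := @hyperplane_form 0%VS z; first by rewrite memv0.
  1,2: exists r, c; split=> //; split=> //; last exact/vanish_rev.
  1,2: split; [by apply/all_form_rcons; split=> //; exact/all_form_rev | | ].
  1,3: move=> u /vanish_rcons[/vanish_rev/Jr/(subvP Jz)/vlineP[a ->]] /eqP.
  1,2: by rewrite formZ // mulf_eq0 (negPf cz) orbF => /eqP->; rewrite scale0r.
  1,2: rewrite size_rcons size_rev -Jn (_ : J = <[z]>%VS) ?dim_vline ?z0 //.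
  1,2: by apply/eqP; rewrite eqEsubv Jz.
  (* For [m = 0] the space [J] has dimension at most 1 and contains [z], so it is the line of
     [z]. *)
  by case/negP; rewrite -(geq_leqif (dimv_leqif_sup zJs)) dim_vline z0.
move=> nJz; have /subvPn[u uJ uW] := ideal_descent nilL zJ zc nJz.
have [c [cl cW cu]] := hyperplane_form uW.
pose c' : {linear L -> F^o} :=
  HB.pack (c : L -> F^o) (GRing.isLinear.Build F L F^o _ (c : L -> F^o) cl).
have memK v : (v \in lker (linfun c')) = (c v == 0) by rewrite memv_ker lfunE.
have dimJ : \dim J = (\dim (J :&: lker (linfun c'))).+1.
  rewrite -(limg_ker_dim (linfun c') J) -addn1; congr (_ + _)%N.
  apply/eqP; rewrite eqn_leq; apply/andP; split.
    by rewrite (leq_trans (dimvS (subvf _))) // dimvf.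
  rewrite lt0n dimv_eq0; apply: contra cu => /eqP imJ.
  have := memv_img (linfun c') uJ; rewrite imJ memv0 lfunE => /eqP cu0.
  exact/eqP.
apply: (IH (c :: r) (J :&: lker (linfun c'))%VS) => //=.
- by rewrite -ltnS -dimJ.
- split=> // x y /Jr xJ; apply: cW.
  by rewrite lieC memvN (subvP (addvSl _ _)) // memv_lie ?memvf.
- by split=> //; apply: cW; rewrite (subvP (addvSr _ _)) // memv_line.
- move=> x; rewrite memv_cap memK; split=> [/andP[/Jr xr /eqP cx]//|[cx xr]].
  by rewrite cx eqxx andbT; apply/Jr.
- by rewrite addnS -addSn -dimJ.
Qed.

Lemma adapted_multiple z cs c : adapted z cs c ->
  forall u, vanish cs u -> u = (c u / c z) *: z.
Proof.
move=> [[csl inj _] csz cz] u csu; apply/subr0_eq/inj/vanish_rcons.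
have /all_form_rcons[l cl] := csl; split.
  by rewrite addrC -scaleNr; exact: vanish_lin.
by rewrite formB // formZ // divfK // subrr.
Qed.

Lemma adapted_free z cs c : adapted z cs c -> free_forms cs.
Proof.
move=> [/frame_free fr _ _] vals sz; have [|e] := fr (rcons vals 0).
  by rewrite !size_rcons sz.
by rewrite map_rcons => /rcons_inj[eE _]; exists e.
Qed.

Lemma lie_expand cs c : all_form cs -> free_forms cs -> linform c ->
    (forall u v, vanish cs u -> c (lie u v) = 0) ->
  exists A, forall u v, c (lie u v) = quad A cs u v.
Proof.
move=> csl fr cl c0; apply: quad_expand => //.
- by move=> v a x y; rewrite lie_is_linearl cl.
- by move=> u v; rewrite lieC -[- _]add0r formB // form0 // sub0r.
- by move=> u; rewrite liexx form0.
Qed.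

(** A vector killed by [cs] is a multiple of the central [z], so [d c] involves only the forms of
    [cs]. *)
Lemma adapted_expand z cs c : adapted z cs c -> witness z ->
  exists A, forall u v, c (lie u v) = quad A cs u v.
Proof.
move=> ad [zc _]; have [[/all_form_rcons[csl cl] _ _] _ _] := ad.
apply: (lie_expand csl (adapted_free ad) cl) => u v /(adapted_multiple ad)->.
by rewrite lieZl zc scaler0 (form0 cl).
Qed.

Lemma scalar_cocycleP (phi : L -> L -> F) :
    (forall w, linform (phi^~ w)) -> (forall u v, phi u v = - phi v u) ->
    (forall u, phi u u = 0) ->
    (forall u v w, phi (lie u v) w + phi (lie v w) u + phi (lie w u) v = 0) ->
  cocycle (phi : L -> L -> F^o).
Proof.
move=> pl pC pxx pcyc; split=> // w a u v.
have pr : linform (phi w).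
  by move=> b x y; rewrite pC pl ![phi _ w]pC; ring.
exact: (pr a u v).
Qed.

(** The cocycle [f ^ c + quad A] takes the value [- c z * f x] at [(z, x)], and this must be 0 for a
    witness. Every later elimination rests on this. *)
Lemma witness_form_eq0 z cs c f A : adapted z cs c -> witness z -> linform f ->
    f z = 0 ->
    (forall u v w, let phi u v := f u * c v - c u * f v + quad A cs u v in
      phi (lie u v) w + phi (lie v w) u + phi (lie w u) v = 0) ->
  forall x, f x = 0.
Proof.
move=> [[/all_form_rcons[csl cl] _ _] csz cz] [_ zphi] fl fz phi0 x.
have /zphi/(_ x) :
    cocycle (fun u v => f u * c v - c u * f v + quad A cs u v : F^o).
  apply: scalar_cocycleP => [w a u v|u v|u|u v w].
  - by rewrite fl cl quad_forml //; ring.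
  - by rewrite quadC; ring.
  - by rewrite quadxx; ring.
  - exact: phi0.
rewrite fz vanish_quad0 // mul0r sub0r addr0 => /eqP.
by rewrite oppr_eq0 mulf_eq0 (negPf cz) => /eqP.
Qed.
End Frames.

(** A notation rather than a definition, so that [ring] and [field] see the products. *)
Notation wedge f g u v := (f u * g v - g u * f v) (only parsing).

(** * Expansions, dual vectors and changes of adapted coordinates *)

Section Adapted.
Variables (F : fieldType) (L : lieVectType F) (z : L).
Hypothesis wit : witness z.
Implicit Types (c f g : L -> F) (cs r : seq (L -> F)).

Lemma lie_cyc f : linform f -> forall u v w,
  f (lie (lie u v) w) + f (lie (lie v w) u) + f (lie (lie w u) v) = 0.
Proof.
move=> fl u v w; rewrite -!formD // -(form0 fl); congr f.
rewrite !(lieC (lie _ _)) -!opprD [X in - X](_ : _ = 0) ?oppr0 //.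
by rewrite -addrA addrC lie_jacobi.
Qed.

Lemma adapted_dual cs c : adapted z cs c ->
  exists e : nat -> L, forall i j, (i < size cs)%N -> (j < size cs)%N ->
    nth (fun=> 0) cs i (e j) = (i == j)%:R.
Proof.
move=> /adapted_free fr.
suff /boolp.choice[e eE] : forall j, exists e, (j < size cs)%N ->
    forall i, (i < size cs)%N -> nth (fun=> 0) cs i e = (i == j)%:R.
  by exists e => i j ics jcs; exact: eE.
move=> j; have [|e eE] := fr (mkseq (fun i => (i == j)%:R) (size cs)).
  by rewrite size_mkseq.
by exists e => _ i ics; rewrite -(nth_map _ 0 (fun c => c e)) // eE nth_mkseq.
Qed.

(** Missing rows and entries read as 0. *)
Definition tab (rows : seq (seq F)) (i j : nat) : F :=
  nth 0 (nth [::] rows i) j.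

(* [rows] lists the coefficients of a primitive of [c1 ^ d c]. *)
Lemma no_witness_by_first c1 cs c rows : adapted z (c1 :: cs) c ->
    (forall u v w,
      let phi u v := c1 u * c v - c u * c1 v + quad (tab rows) (c1 :: cs) u v in
      phi (lie u v) w + phi (lie v w) u + phi (lie w u) v = 0) ->
  False.
Proof.
move=> ad phi0; have [[[l1 _] _ _] [z1 _] _] := ad.
have [e [e1 _]] := free_forms_dual (adapted_free ad).
by move/eqP: e1; rewrite (witness_form_eq0 ad wit l1 z1 phi0) eq_sym oner_eq0.
Qed.

Lemma adapted_expand4 c1 c2 c3 c4 c : adapted z [:: c1; c2; c3; c4] c ->
  exists a12 a13 a14 a23 a24 a34, forall u v, c (lie u v) =
    a12 * wedge c1 c2 u v + a13 * wedge c1 c3 u v + a14 * wedge c1 c4 u v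
    + a23 * wedge c2 c3 u v + a24 * wedge c2 c4 u v + a34 * wedge c3 c4 u v.
Proof.
move=> ad; have [A dc] := adapted_expand ad wit.
exists (A 0 0)%N, (A 0 1)%N, (A 0 2)%N, (A 1 0)%N, (A 1 1)%N, (A 2 0)%N.
by move=> u v; rewrite dc /=; ring.
Qed.

Lemma adapted_expand5 c1 c2 c3 c4 c5 c : adapted z [:: c1; c2; c3; c4; c5] c ->
  exists a12 a13 a14 a15 a23 a24 a25 a34 a35 a45, forall u v, c (lie u v) =
    a12 * wedge c1 c2 u v + a13 * wedge c1 c3 u v + a14 * wedge c1 c4 u v
    + a15 * wedge c1 c5 u v + a23 * wedge c2 c3 u v + a24 * wedge c2 c4 u v
    + a25 * wedge c2 c5 u v + a34 * wedge c3 c4 u v + a35 * wedge c3 c5 u v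
    + a45 * wedge c4 c5 u v.
Proof.
move=> ad; have [A dc] := adapted_expand ad wit.
exists (A 0 0)%N, (A 0 1)%N, (A 0 2)%N, (A 0 3)%N, (A 1 0)%N, (A 1 1)%N,
  (A 1 2)%N, (A 2 0)%N, (A 2 1)%N, (A 3 0)%N.
by move=> u v; rewrite dc /=; ring.
Qed.

Lemma adapted_equiv cs cs' c : adapted z cs c -> all_form cs' ->
    size cs' = size cs -> (forall u, vanish cs' u <-> vanish cs u) ->
  adapted z cs' c.
Proof.
move=> [[/all_form_rcons[_ cl] inj sz] csz cz] csl' sz' eqv; split=> //.
  split; first exact/all_form_rcons.
    by move=> u /vanish_rcons[/eqv csu cu]; apply/inj/vanish_rcons.
  by rewrite -sz !size_rcons sz'.
exact/eqv.
Qed.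

Lemma adapted_last cs c c' : adapted z cs c -> linform c' -> c' z != 0 ->
  adapted z cs c'.
Proof.
move=> ad c'l c'z; have [[/all_form_rcons[csl cl] _ sz] csz cz] := ad.
split=> //; split; first exact/all_form_rcons.
  move=> u /vanish_rcons[/(adapted_multiple ad)->] /eqP.
  by rewrite formZ // mulf_eq0 (negPf c'z) orbF => /eqP->; rewrite scale0r.
by rewrite -sz !size_rcons.
Qed.

Lemma frame_equiv cs cs' : frame cs -> all_form cs' -> size cs' = size cs ->
  (forall u, vanish cs' u -> vanish cs u) -> frame cs'.
Proof.
move=> [_ inj sz] csl' sz' eqv; split=> //; last by rewrite sz'.
by move=> u /eqv/inj.
Qed.

(** On dual vectors the Jacobi identity becomes a linear relation between single coefficients. The
    numbering starts at 0: [e 0] is dual to [c1]. The values of [c] on these vectors are left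
    open. *)
Lemma adapted_jacobi4 c1 c2 c3 c4 c : adapted z [:: c1; c2; c3; c4] c ->
  exists e : nat -> L,
    (forall f, linform f -> forall i j k, f (lie (lie (e i) (e j)) (e k)) +
      f (lie (lie (e j) (e k)) (e i)) + f (lie (lie (e k) (e i)) (e j)) = 0) /\
    [/\ forall j, (j < 4)%N -> c1 (e j) = (0 == j)%N%:R,
        forall j, (j < 4)%N -> c2 (e j) = (1 == j)%N%:R,
        forall j, (j < 4)%N -> c3 (e j) = (2 == j)%N%:R &
        forall j, (j < 4)%N -> c4 (e j) = (3 == j)%N%:R].
Proof.
move=> ad; have [e E] := adapted_dual ad; exists e; split.
  by move=> f fl *; exact: lie_cyc.
by split=> j jn; [exact: (E 0 j)%N | exact: (E 1 j)%N | exact: (E 2 j)%N |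
  exact: (E 3 j)%N].
Qed.

Lemma adapted_jacobi5 c1 c2 c3 c4 c5 c : adapted z [:: c1; c2; c3; c4; c5] c ->
  exists e : nat -> L,
    (forall f, linform f -> forall i j k, f (lie (lie (e i) (e j)) (e k)) +
      f (lie (lie (e j) (e k)) (e i)) + f (lie (lie (e k) (e i)) (e j)) = 0) /\
    [/\ forall j, (j < 5)%N -> c1 (e j) = (0 == j)%N%:R,
        forall j, (j < 5)%N -> c2 (e j) = (1 == j)%N%:R,
        forall j, (j < 5)%N -> c3 (e j) = (2 == j)%N%:R,
        forall j, (j < 5)%N -> c4 (e j) = (3 == j)%N%:R &
        forall j, (j < 5)%N -> c5 (e j) = (4 == j)%N%:R].
Proof.
move=> ad; have [e E] := adapted_dual ad; exists e; split.
  by move=> f fl *; exact: lie_cyc.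
by split=> j jn; [exact: (E 0 j)%N | exact: (E 1 j)%N | exact: (E 2 j)%N |
  exact: (E 3 j)%N | exact: (E 4 j)%N].
Qed.

Lemma mulf_cancel (a x : F) : a != 0 -> a * x = 0 -> x = 0.
Proof. by move=> /negPf a0 /eqP; rewrite mulf_eq0 a0 => /eqP. Qed.

Lemma divf_cancel (a x : F) : a != 0 -> x / a = 0 -> x = 0.
Proof. by rewrite mulrC -invr_eq0; exact: mulf_cancel. Qed.
End Adapted.

(** * Tactics for computing with coordinates and their differentials *)

Ltac lin_tac :=
  intros ? ? ?; cbv beta;
  repeat match goal with
  | H : linform ?c |- context [?c (?a *: ?u + ?v)] => rewrite (H a u v)
  end; ring.

Ltac splits :=
  simpl; repeat match goal with
  | |- _ /\ _ => split
  | |- True => exact I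
  end.

Ltac forms_tac := splits; try assumption; lin_tac.

Ltac diff_rewrite :=
  cbv beta;
  repeat match goal with
  | H : forall u v, ?c (lie u v) = @?P u v |- context [?c (lie ?x ?y)] =>
      rewrite (H x y); cbv beta
  end.

Ltac diff_tac :=
  intros; diff_rewrite;
  first [ring | field; repeat (apply/andP; split); assumption].

Ltac dual_rewrite :=
  repeat match goal with
  | H : forall j, is_true (leq (S j) _) -> ?c (?e j) = @?P j
      |- context [?c (?e ?k)] => rewrite (H k isT)
  end; simpl.

(** The left side of the Jacobi identity [J] is substituted for 0; on dual vectors it evaluates to
    the coefficient sought. *)
Ltac coef_tac J := rewrite -J; diff_rewrite; dual_rewrite; ring.

Ltac closed_tac := move=> ? ? ?; rewrite /tab /=; diff_rewrite; ring.

Ltac iso6_tac :=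
  move=> [|[|[|[|[|[|[|?]]]]]]] ? ? //= _; diff_rewrite;
  first [ring | field; repeat (apply/andP; split); assumption].

(** Solves a triangular system: known zeros are substituted and nonzero factors cancelled. *)
Ltac vanish_simpl := repeat first
  [ match goal with
    | H : ?c ?u = 0, H' : context [?c ?u] |- _ =>
        is_var c; tryif constr_eq H H' then fail else rewrite H in H'
    end
  | match goal with
    | H : _ = 0 |- _ =>
        let T := type of H in
        rewrite ?(mulr0, mul0r, addr0, add0r, subr0, sub0r, oppr0) in H;
        let T' := type of H in tryif constr_eq T T' then fail else idtac
    end
  | match goal with H : - _ = 0 |- _ => apply oppr_eq0_inj in H end
  | match goal with
    | n : is_true (?a != 0), H : ?a * _ = 0 |- _ => apply (mulf_cancel n) in H
    | n : is_true (?a != 0), H : _ / ?a = 0 |- _ => apply (divf_cancel n) in H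
    end ].

Ltac vanish_tac :=
  intro; simpl;
  try match goal with |- _ <-> _ => split end;
  intros; repeat match goal with H : _ /\ _ |- _ => destruct H end;
  vanish_simpl; splits;
  repeat match goal with
  | H : ?c ?u = 0 |- context [?c ?u] => is_var c; rewrite H
  end;
  rewrite ?(mulr0, mul0r, addr0, add0r, subr0, sub0r, oppr0); try reflexivity.

(** * Extensions of algebras of dimension 5 *)

Section Heisenberg.
Variables (F : fieldType) (L : lieVectType F) (z : L).
Hypothesis wit : witness z.
Implicit Types (c f g : L -> F) (cs r : seq (L -> F)).

(** Here [L / z] is free nilpotent of class 3 on two generators. The Jacobi identity leaves
    [c1 ^ d c6] in the span of the [c1 ^ c2 ^ c_j], which are differentials of [c2 ^ c4], [c3 ^ c4],
    [c3 ^ c5]. *)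
Lemma no_witness_L5_9 c1 c2 c3 c4 c5 c6 : adapted z [:: c1; c2; c3; c4; c5] c6 ->
    (forall u v, c1 (lie u v) = 0) -> (forall u v, c2 (lie u v) = 0) ->
    (forall u v, c3 (lie u v) = wedge c1 c2 u v) ->
    (forall u v, c4 (lie u v) = wedge c1 c3 u v) ->
    (forall u v, c5 (lie u v) = wedge c2 c3 u v) -> False.
Proof.
move=> ad d1 d2 d3 d4 d5.
have [a12 [a13 [a14 [a15 [a23 [a24 [a25 [a34 [a35 [a45 d6]]]]]]]]]] :=
  adapted_expand5 wit ad.
have [[[_ [_ [_ [_ [_ [l6 _]]]]]] _ _] _ _] := ad.
have [e [/(_ c6 l6) J [E1 E2 E3 E4 E5]]] := adapted_jacobi5 ad.
have Z34 : a34 = 0 by coef_tac (J 0 1 3)%N.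
have Z35 : a35 = 0 by coef_tac (J 0 1 4)%N.
have Z45 : a45 = 0 by coef_tac (J 0 2 4)%N.
subst a34 a35 a45.
apply: (no_witness_by_first wit
  (rows := [:: [::]; [:: 0; a23; 0]; [:: a24; a25]; [::]]) ad).
by closed_tac.
Qed.

(** For [b = 0] the quotient [L / z] is the filiform algebra of dimension 4 plus a line; the same
    primitive serves for all [b]. *)
Lemma no_witness_L5_5 b c1 c2 c3 c4 c5 c6 :
    adapted z [:: c1; c2; c3; c4; c5] c6 ->
    (forall u v, c1 (lie u v) = 0) -> (forall u v, c2 (lie u v) = 0) ->
    (forall u v, c3 (lie u v) = 0) ->
    (forall u v, c4 (lie u v) = wedge c1 c2 u v) ->
    (forall u v, c5 (lie u v) = wedge c1 c4 u v + b * wedge c2 c3 u v) -> False.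
Proof.
move=> ad d1 d2 d3 d4 d5.
have [a12 [a13 [a14 [a15 [a23 [a24 [a25 [a34 [a35 [a45 d6]]]]]]]]]] :=
  adapted_expand5 wit ad.
have [[[_ [_ [_ [_ [_ [l6 _]]]]]] _ _] _ _] := ad.
have [e [/(_ c6 l6) J [E1 E2 E3 E4 E5]]] := adapted_jacobi5 ad.
have Z25 : a25 = 0 by coef_tac (J 0 1 3)%N.
have Z35 : a35 = 0 by coef_tac (J 0 2 3)%N.
have Z45 : a45 = 0 by coef_tac (J 0 1 4)%N.
subst a25 a35 a45.
apply: (no_witness_by_first wit
  (rows := [:: [::]; [:: 0; 0; a24]; [:: - a23; a34]; [::]]) ad).
by closed_tac.
Qed.

(** The products [c_i ^ d c5] with [i <= 4] span the 3-forms in [c1, ..., c4]. So [c1 ^ d c6] is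
    exact once the Jacobi identity has removed [c5] from [d c6]. *)
Lemma no_witness_heisenberg2 c1 c2 c3 c4 c5 c6 :
    adapted z [:: c1; c2; c3; c4; c5] c6 ->
    (forall u v, c1 (lie u v) = 0) -> (forall u v, c2 (lie u v) = 0) ->
    (forall u v, c3 (lie u v) = 0) -> (forall u v, c4 (lie u v) = 0) ->
    (forall u v, c5 (lie u v) = wedge c1 c2 u v + wedge c3 c4 u v) -> False.
Proof.
move=> ad d1 d2 d3 d4 d5.
have [a12 [a13 [a14 [a15 [a23 [a24 [a25 [a34 [a35 [a45 d6]]]]]]]]]] :=
  adapted_expand5 wit ad.
have [[[_ [_ [_ [_ [_ [l6 _]]]]]] _ _] _ _] := ad.
have [e [/(_ c6 l6) J [E1 E2 E3 E4 E5]]] := adapted_jacobi5 ad.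
have Z15 : a15 = 0 by coef_tac (J 2 0 3)%N.
have Z25 : a25 = 0 by coef_tac (J 2 1 3)%N.
have Z35 : a35 = 0 by coef_tac (J 1 0 2)%N.
have Z45 : a45 = 0 by coef_tac (J 1 0 3)%N.
subst a15 a25 a35 a45.
apply: (no_witness_by_first wit
  (rows := [:: [:: 0; 0; 0; - a34]; [::]; [:: 0; - a23]; [:: - a24]]) ad).
by closed_tac.
Qed.

Definition listed6 : Prop :=
  lie_isomorphic L (L6_4 F) \/
  lie_isomorphic L (L6_10 F) \/
  lie_isomorphic L (L6_14 F) \/
  lie_isomorphic L (L6_16 F) \/
  (exists eps : F, lie_isomorphic L (L6_19 eps)) \/
  lie_isomorphic L (L6_20 F).

Lemma heisenberg1_ext a12 a13 a14 a23 a24 a34 c1 c2 c3 c4 c5 c6 :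
    adapted z [:: c1; c2; c3; c4; c5] c6 ->
    (forall u v, c1 (lie u v) = 0) -> (forall u v, c2 (lie u v) = 0) ->
    (forall u v, c3 (lie u v) = 0) -> (forall u v, c4 (lie u v) = 0) ->
    (forall u v, c5 (lie u v) = wedge c1 c2 u v) ->
    (forall u v, c6 (lie u v) = a12 * wedge c1 c2 u v + a13 * wedge c1 c3 u v
      + a14 * wedge c1 c4 u v + wedge c1 c5 u v + a23 * wedge c2 c3 u v
      + a24 * wedge c2 c4 u v + a34 * wedge c3 c4 u v) ->
  listed6.
Proof.
move=> ad d1 d2 d3 d4 d5 d6.
case: (eqVneq a34 0) => [Z34|a34n].
  subst a34; exfalso; apply: (no_witness_by_first wit
    (rows := [:: [::]; [::]; [:: 0; - a23]; [:: - a24]]) ad).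
  by closed_tac.
have [fr _ _] := ad; have [[l1 [l2 [l3 [l4 [l5 [l6 _]]]]]] _ _] := fr.
right; left.
(* The third form collects the partners of [c1] in [d c6]; the fourth and fifth factor the rest as
   [(a34 c3 + a24 c2) ^ (c4 - (a23 / a34) c2)]. *)
apply: (@table_iso _ _ _ (LieTable (@L6_10_jacobi F)) [:: c1; c2;
  (fun u => c5 u + a12 * c2 u + a13 * c3 u + a14 * c4 u);
  (fun u => a34 * c3 u + a24 * c2 u);
  (fun u => c4 u - a23 / a34 * c2 u); c6]) => //.
  apply: (frame_equiv fr) => //; first by forms_tac.
  by vanish_tac.
by iso6_tac.
Qed.
End Heisenberg.

(** * Extensions of [H(1) + A(2)] and of the filiform algebras *)

Section Filiform.
Variables (F : fieldType) (L : lieVectType F) (z : L).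
Hypothesis wit : witness z.
Implicit Types (c f g : L -> F) (cs r : seq (L -> F)).
Local Notation listed6 := (listed6 L).

(** The partner of [c5] in [d c6] is [a15 c1 + a25 c2]. If it is nonzero it becomes the new [c1],
    with a second form chosen to preserve [c1 ^ c2]; if it is zero, a nonzero form has exact product
    with [d c6]. *)
Lemma heisenberg1_case c1 c2 c3 c4 c5 c6 :
    adapted z [:: c1; c2; c3; c4; c5] c6 ->
    (forall u v, c1 (lie u v) = 0) -> (forall u v, c2 (lie u v) = 0) ->
    (forall u v, c3 (lie u v) = 0) -> (forall u v, c4 (lie u v) = 0) ->
    (forall u v, c5 (lie u v) = wedge c1 c2 u v) -> listed6.
Proof.
move=> ad d1 d2 d3 d4 d5.
have [a12 [a13 [a14 [a15 [a23 [a24 [a25 [a34 [a35 [a45 d6]]]]]]]]]] :=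
  adapted_expand5 wit ad.
have [[[l1 [l2 [l3 [l4 [l5 [l6 _]]]]]] _ _] [z1 [z2 [z3 [z4 [z5 _]]]]] _] := ad.
have [e [/(_ c6 l6) J [E1 E2 E3 E4 E5]]] := adapted_jacobi5 ad.
have Z35 : a35 = 0 by coef_tac (J 1 0 2)%N.
have Z45 : a45 = 0 by coef_tac (J 1 0 3)%N.
subst a35 a45; clear J.
case: (eqVneq a15 0) => [Z15|a15n]; last first.
  apply: (@heisenberg1_ext _ _ _ wit a12 (a13 / a15) (a14 / a15)
    (a23 * a15 - a13 * a25) (a24 * a15 - a14 * a25) a34
    (fun u => a15 * c1 u + a25 * c2 u) (fun u => c2 u / a15) c3 c4 c5 c6).
  - apply: (adapted_equiv ad) => //; first by forms_tac.
    by vanish_tac.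
  - by diff_tac.
  - by diff_tac.
  - by diff_tac.
  - by diff_tac.
  - by diff_tac.
  - by diff_tac.
case: (eqVneq a25 0) => [Z25|a25n]; last first.
  subst a15.
  apply: (@heisenberg1_ext _ _ _ wit a12 (a23 / a25) (a24 / a25)
    (- a13 * a25) (- a14 * a25) a34
    (fun u => a25 * c2 u) (fun u => - c1 u / a25) c3 c4 c5 c6).
  - apply: (adapted_equiv ad) => //; first by forms_tac.
    by vanish_tac.
  - by diff_tac.
  - by diff_tac.
  - by diff_tac.
  - by diff_tac.
  - by diff_tac.
  - by diff_tac.
subst a15 a25; exfalso.
case: (eqVneq a34 0) => [Z34|a34n].
  subst a34; apply: (no_witness_by_first wit
    (rows := [:: [::]; [::]; [:: 0; - a23]; [:: - a24]]) ad).
  by closed_tac.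
(* Modulo the exact form [c1 ^ c2], [d c6] is the product of [f] and a form. *)
pose f u := a34 * c3 u + a14 * c1 u + a24 * c2 u.
have fl : linform f by rewrite /f; lin_tac.
have fz : f z = 0 by rewrite /f z1 z2 z3; ring.
have := witness_form_eq0 ad wit fl fz
  (A := tab [:: [::]; [::]; [:: 0; - (a34 * a12 + a14 * a23 - a24 * a13)]; [::]]).
(* The vector [e 2] is dual to [c3], so [f] takes the value [a34] there. *)
rewrite /f => K; have {K} := K _ (e 2%N); dual_rewrite.
rewrite !mulr0 !addr0 mulr1 => K.
by case/eqP: a34n; apply: K; closed_tac.
Qed.

Lemma filiform_case b c1 c2 c3 c4 c5 c6 : (2 : F) != 0 ->
    adapted z [:: c1; c2; c3; c4; c5] c6 ->
    (forall u v, c1 (lie u v) = 0) -> (forall u v, c2 (lie u v) = 0) ->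
    (forall u v, c3 (lie u v) = wedge c1 c2 u v) ->
    (forall u v, c4 (lie u v) = wedge c1 c3 u v) ->
    (forall u v, c5 (lie u v) = wedge c1 c4 u v + b * wedge c2 c3 u v) ->
    b = 0 \/ b = 1 -> listed6.
Proof.
move=> two ad d1 d2 d3 d4 d5 b01.
have [a12 [a13 [a14 [a15 [a23 [a24 [a25 [a34 [a35 [a45 d6]]]]]]]]]] :=
  adapted_expand5 wit ad.
have [fr _ _] := ad; have [[l1 [l2 [l3 [l4 [l5 [l6 _]]]]]] _ _] := fr.
have [e [/(_ c6 l6) J [E1 E2 E3 E4 E5]]] := adapted_jacobi5 ad.
have Z35 : a35 = 0 by coef_tac (J 0 1 4)%N.
have Z45 : a45 = 0 by coef_tac (J 0 2 4)%N.
have Z24 : a24 - b * a15 = 0 by coef_tac (J 0 1 2)%N.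
have Z34 : a34 + a25 = 0 by coef_tac (J 0 1 3)%N.
move/subr0_eq: Z24 => Z24; move/eqP: Z34; rewrite addr_eq0 => /eqP Z34.
subst a35 a45 a24 a34; clear J.
case: (eqVneq a25 0) => [Z25|a25n].
  subst a25; exfalso; apply: (no_witness_by_first wit
    (rows := [:: [::]; [:: 0; a23; 0]; [:: b * a15; 0]; [::]]) ad).
  by closed_tac.
(* [t] absorbs [c1 ^ c5] into [x2 ^ x5], and [k] is the multiple of [d c5] split off from [d c6].
   What remains of [c2 ^ c3] is shared equally between [x2 ^ x5] and [- c3 ^ x4] by means of [s];
   hence the division by 2. *)
pose t := a15 / a25; pose k := a14 - b * a15 * t.
pose s := (a23 - b * k) / (2 * a25).
pose x2 u := c2 u + t * c1 u.
pose x4 u := c4 u + s * x2 u.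
pose x5 u := c5 u + s * c3 u + b * t * c4 u.
pose x6 u := (c6 u - a12 * c3 u - (a13 - (a23 - b * k) * t) * c4 u - k * c5 u) / a25.
have frX : frame [:: c1; x2; c3; x4; x5; x6].
  rewrite /x6 /x5 /x4 /x2; apply: (frame_equiv fr) => //; first by forms_tac.
  by vanish_tac.
have dx2 u v : x2 (lie u v) = 0 by rewrite /x2; diff_tac.
have dx4 u v : x4 (lie u v) = wedge c1 c3 u v by rewrite /x4 /x2; diff_tac.
have dx5 u v : x5 (lie u v) = wedge c1 x4 u v + b * wedge x2 c3 u v.
  by rewrite /x5 /x4 /x2; diff_tac.
have dx6 u v : x6 (lie u v) = wedge x2 x5 u v - wedge c3 x4 u v.
  by rewrite /x6 /x5 /x4 /x2 /s /k /t; diff_tac.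
have dx3 u v : c3 (lie u v) = wedge c1 x2 u v by rewrite /x2; diff_tac.
(* The new coordinates become opaque; only their differentials are used from here on. *)
move: frX dx2 dx3 dx4 dx5 dx6; move: x2 x4 x5 x6.
move=> x2 x4 x5 x6 frX dx2 dx3 dx4 dx5 dx6 {d2 d3 d4 d5 d6 ad}.
case: b01 dx5 => -> dx5.
  do 3 right; left.
  apply: (@table_iso _ _ _ (LieTable (@L6_16_jacobi F)) _ frX) => //.
  by iso6_tac.
do 2 right; left.
apply: (@table_iso _ _ _ (LieTable (@L6_14_jacobi F)) _ frX) => //.
by iso6_tac.
Qed.
End Filiform.

(** * Extensions of the algebra with [d c4 = c1 ^ c2], [d c5 = c1 ^ c3] *)

Section Pencil.
Variables (F : fieldType) (L : lieVectType F) (z : L).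
Hypothesis wit : witness z.
Implicit Types (c f g : L -> F) (cs r : seq (L -> F)).
Local Notation listed6 := (listed6 L).

Lemma pencil_diagonal a12 a13 a14 a15 a23 a35 c1 c2 c3 c4 c5 c6 :
    adapted z [:: c1; c2; c3; c4; c5] c6 ->
    (forall u v, c1 (lie u v) = 0) -> (forall u v, c2 (lie u v) = 0) ->
    (forall u v, c3 (lie u v) = 0) ->
    (forall u v, c4 (lie u v) = wedge c1 c2 u v) ->
    (forall u v, c5 (lie u v) = wedge c1 c3 u v) ->
    (forall u v, c6 (lie u v) = a12 * wedge c1 c2 u v + a13 * wedge c1 c3 u v
      + a14 * wedge c1 c4 u v + a15 * wedge c1 c5 u v + a23 * wedge c2 c3 u v
      + wedge c2 c4 u v + a35 * wedge c3 c5 u v) ->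
  listed6.
Proof.
move=> ad d1 d2 d3 d4 d5 d6.
have [fr [z1 [z2 _]] _] := ad.
have [[l1 [l2 [l3 [l4 [l5 [l6 _]]]]]] _ _] := fr.
case: (eqVneq a35 0) => [Z35|a35n]; last first.
  do 4 right; left; exists a35.
  (* The second form absorbs [c1 ^ c4], the third leaves coefficient 1 on [c1 ^ c5], the fourth
     absorbs [c2 ^ c3], and the last removes the exact terms. *)
  apply: (@table_iso _ _ _ (LieTable (L6_19_jacobi a35)) [:: c1;
    (fun u => c2 u + a14 * c1 u); (fun u => c3 u + (a15 - 1) / a35 * c1 u);
    (fun u => c4 u + a23 * c3 u); c5;
    (fun u => c6 u - a12 * c4 u - (a13 - a14 * a23) * c5 u)]) => //.
    apply: (frame_equiv fr) => //; first by forms_tac.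
    by vanish_tac.
  by iso6_tac.
subst a35; case: (eqVneq a15 0) => [Z15|a15n]; last first.
  do 5 right.
  apply: (@table_iso _ _ _ (LieTable (@L6_20_jacobi F)) [:: c1;
    (fun u => c2 u + a14 * c1 u); (fun u => a15 * c3 u);
    (fun u => c4 u + a23 * c3 u); (fun u => a15 * c5 u);
    (fun u => c6 u - a12 * c4 u - (a13 - a14 * a23) * c5 u)]) => //.
    apply: (frame_equiv fr) => //; first by forms_tac.
    by vanish_tac.
  by iso6_tac.
subst a15; exfalso.
(* [f] is the partner of [c4] in [d c6], so [f ^ d c6] is a multiple of
   [c1 ^ c2 ^ c3 = d (c2 ^ c5)]. *)
pose f u := c2 u + a14 * c1 u.
have fl : linform f by rewrite /f; lin_tac.
have fz : f z = 0 by rewrite /f z1 z2; ring.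
have [e [_ [E1 E2 _ _ _]]] := adapted_jacobi5 ad.
have K := witness_form_eq0 ad wit fl fz
  (A := tab [:: [::]; [:: 0; 0; a14 * a23 - a13]; [::]; [::]]).
have : f (e 1%N) = 0 by apply: K; rewrite /f; closed_tac.
by rewrite /f; dual_rewrite; rewrite mulr0 addr0 => /eqP; rewrite oner_eq0.
Qed.

(** The coefficients [a24, a25, a35] are those of a symmetric bilinear form, [c4, c5] transforming
    like [c2, c3]. With pivot [a24] the square is completed. *)
Lemma pencil_pivot a12 a13 a14 a15 a23 a24 a25 a35 c1 c2 c3 c4 c5 c6 :
    adapted z [:: c1; c2; c3; c4; c5] c6 ->
    (forall u v, c1 (lie u v) = 0) -> (forall u v, c2 (lie u v) = 0) ->
    (forall u v, c3 (lie u v) = 0) ->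
    (forall u v, c4 (lie u v) = wedge c1 c2 u v) ->
    (forall u v, c5 (lie u v) = wedge c1 c3 u v) ->
    (forall u v, c6 (lie u v) = a12 * wedge c1 c2 u v + a13 * wedge c1 c3 u v
      + a14 * wedge c1 c4 u v + a15 * wedge c1 c5 u v + a23 * wedge c2 c3 u v
      + a24 * wedge c2 c4 u v + a25 * (wedge c2 c5 u v + wedge c3 c4 u v)
      + a35 * wedge c3 c5 u v) ->
  a24 != 0 -> listed6.
Proof.
move=> ad d1 d2 d3 d4 d5 d6 a24n.
have [[[l1 [l2 [l3 [l4 [l5 [l6 _]]]]]] _ _] _ z6] := ad.
have ad' : adapted z [:: c1; c2; c3; c4; c5] (fun u => c6 u / a24).
  apply: (adapted_last ad); first by lin_tac.
  by rewrite mulf_neq0 // invr_neq0.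
apply: (@pencil_diagonal (a12 / a24) ((a13 - a12 * a25 / a24) / a24) (a14 / a24)
  ((a15 - a14 * a25 / a24) / a24) (a23 / a24) ((a35 - a25 ^+ 2 / a24) / a24)
  c1 (fun u => c2 u + a25 / a24 * c3 u) c3
  (fun u => c4 u + a25 / a24 * c5 u) c5 (fun u => c6 u / a24)).
- apply: (adapted_equiv ad') => //; first by forms_tac.
  by vanish_tac.
- by diff_tac.
- by diff_tac.
- by diff_tac.
- by diff_tac.
- by diff_tac.
- by diff_tac.
Qed.

(** The Jacobi identity gives [a34 = a25], that is, symmetry. A nonzero symmetric form acquires a
    nonzero pivot after exchanging [c2] and [c3] or replacing [c3] by [c3 - c2], which gives the
    pivot [2 * a25]; the zero form admits no witness. *)
Lemma pencil_case c1 c2 c3 c4 c5 c6 : (2 : F) != 0 ->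
    adapted z [:: c1; c2; c3; c4; c5] c6 ->
    (forall u v, c1 (lie u v) = 0) -> (forall u v, c2 (lie u v) = 0) ->
    (forall u v, c3 (lie u v) = 0) ->
    (forall u v, c4 (lie u v) = wedge c1 c2 u v) ->
    (forall u v, c5 (lie u v) = wedge c1 c3 u v) -> listed6.
Proof.
move=> two ad d1 d2 d3 d4 d5.
have [a12 [a13 [a14 [a15 [a23 [a24 [a25 [a34 [a35 [a45 d6]]]]]]]]]] :=
  adapted_expand5 wit ad.
have [[[l1 [l2 [l3 [l4 [l5 [l6 _]]]]]] _ _] _ _] := ad.
have [e [/(_ c6 l6) J [E1 E2 E3 E4 E5]]] := adapted_jacobi5 ad.
have Z45 : a45 = 0 by coef_tac (J 0 1 4)%N.
have Z34 : a25 - a34 = 0 by coef_tac (J 0 1 2)%N.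
move/subr0_eq: Z34 => Z34; subst a45 a34; clear J.
case: (eqVneq a24 0) => [Z24|a24n]; last first.
  by apply: (@pencil_pivot a12 a13 a14 a15 a23 a24 a25 a35 c1 c2 c3 c4 c5 c6)
    => //; diff_tac.
subst a24; case: (eqVneq a35 0) => [Z35|a35n]; last first.
  apply: (@pencil_pivot a13 a12 a15 a14 (- a23) a35 a25 0 c1 c3 c2 c5 c4 c6) => //.
    by apply: (adapted_equiv ad) => //; vanish_tac.
  by diff_tac.
subst a35; case: (eqVneq a25 0) => [Z25|a25n]; last first.
  apply: (@pencil_pivot (a12 + a13) a13 (a14 + a15) a15 a23 (2 * a25) a25 0
    c1 c2 (fun u => c3 u - c2 u) c4 (fun u => c5 u - c4 u) c6) => //.
  - apply: (adapted_equiv ad) => //; first by forms_tac.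
    by vanish_tac.
  - by diff_tac.
  - by diff_tac.
  - by diff_tac.
  - by rewrite mulf_neq0.
subst a25; exfalso; apply: (no_witness_by_first wit
  (rows := [:: [::]; [:: 0; 0; a23]; [::]; [::]]) ad).
by closed_tac.
Qed.
End Pencil.

(** * Darboux normal form of a 2-form *)

Section Darboux.
Variables (F : fieldType) (L : lieVectType F).
Implicit Types (c f g : L -> F) (cs r : seq (L -> F)).

Fixpoint darboux (k : nat) cs (u v : L) : F :=
  match k, cs with
  | k'.+1, x :: y :: cs' => wedge x y u v + darboux k' cs' u v
  | _, _ => 0
  end.

Lemma all_form_cat cs r : all_form (cs ++ r) <-> all_form cs /\ all_form r.
Proof. by elim: cs => [|c cs IH] /=; [tauto | rewrite IH; tauto]. Qed.

Lemma vanish_cat cs r u : vanish (cs ++ r) u <-> vanish cs u /\ vanish r u.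
Proof. by elim: cs => [|c cs IH] /=; [tauto | rewrite IH; tauto]. Qed.

Lemma frame_cat_free cs r : frame (cs ++ r) -> free_forms cs.
Proof.
move=> /frame_free fr vals sz; have [|e] := fr (vals ++ nseq (size r) 0).
  by rewrite !size_cat sz size_nseq.
rewrite map_cat => /eqP; rewrite eqseq_cat ?size_map //.
by case/andP => /eqP <- _; exists e.
Qed.

(** Steinitz exchange, stated through common zeros: the combination replaces a form that has a
    nonzero coefficient in it. *)
Lemma lin_exchange a cs : all_form cs -> (exists u, lin a cs u != 0) ->
  exists cs', [/\ all_form cs', size cs = (size cs').+1 &
    forall u, lin a cs u = 0 /\ vanish cs' u <-> vanish cs u].
Proof.
elim: cs a => [|c cs IH] a /=; first by move=> _ [u]; rewrite eqxx.
move=> [cl csl] [u lu]; case: (eqVneq (a 0%N) 0) => [a0|a0].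
  have [|cs' [csl' sz eqv]] := IH (fun i => a i.+1) csl.
    by exists u; move: lu; rewrite a0 mul0r add0r.
  exists (c :: cs'); split=> [||v] //=; first by rewrite sz.
  by rewrite a0 mul0r add0r -eqv; tauto.
exists cs; split=> // v; split=> [[+ csv]|[cv csv]]; last first.
  by rewrite cv vanish_lin0 // mulr0 addr0.
by rewrite vanish_lin0 // addr0 => /(mulf_cancel a0).
Qed.

Lemma darboux_rcons k cs c u v : (k.*2 <= size cs)%N ->
  darboux k (rcons cs c) u v = darboux k cs u v.
Proof.
by elim: k cs => [|k IH] [|x [|y cs]] //=; rewrite doubleS !ltnS => /IH->.
Qed.

(** If the first form [c] does not occur, it is moved to the end; otherwise its partner [y] and a
    corrected [c] make the first pair. The list [r] completes [cs] to a frame, so that forms set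
    aside stay independent of those still treated. *)
Lemma darboux_normal_form cs r A : frame (cs ++ r) ->
  exists xs k, [/\ all_form xs, size xs = size cs,
    forall u, vanish xs u <-> vanish cs u, (k.*2 <= size xs)%N &
    forall u v, quad A cs u v = darboux k xs u v].
Proof.
have [n] := ubnP (size cs); elim: n cs r A => // n IH [|c cs] r A.
  by move=> _ _; exists [::], 0%N.
rewrite /= ltnS => csn fr.
have [/= [cl /all_form_cat[csl rl]] inj sz] := fr.
have [lin0|] := pselect (forall u, lin (A 0%N) cs u = 0).
  have [||xs [k [xsl xsz eqv kn quadE]]] := IH cs (c :: r) (fun i => A i.+1).
  - exact: csn.
  - split; first exact/all_form_cat.
      by move=> u /vanish_cat[csu [cu ru]]; apply: inj; split=> //; apply/vanish_cat.
    by rewrite -sz /= !size_cat /= addnS.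
  exists (rcons xs c), k; split.
  - exact/all_form_rcons.
  - by rewrite size_rcons xsz.
  - by move=> u; rewrite vanish_rcons eqv; tauto.
  - by rewrite size_rcons (leq_trans kn).
  - by move=> u v; rewrite !lin0 quadE darboux_rcons //; ring.
move/existsNP => [u0 /eqP lu0].
have [|cs' [csl' sz' eqv]] := lin_exchange csl (a := A 0%N).
  by exists u0.
set y := lin (A 0%N) cs; have yl : linform y by exact: lin_form.
have fr' : frame ((y :: cs') ++ c :: r).
  split; first by split=> //; apply/all_form_cat.
    move=> u [yu /vanish_cat[csu [cu ru]]]; apply: inj; split=> //.
    by apply/vanish_cat; split=> //; apply/eqv.
  by rewrite -sz /= !size_cat /= sz' addnS.
have [|||||B quadE] := quad_expand (cs := y :: cs')
  (phi := quad (fun i => A i.+1) cs) _ (frame_cat_free fr').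
- by [].
- by move=> v; exact: quad_forml.
- by move=> u v; exact: quadC.
- by move=> u; exact: quadxx.
- by move=> u v /eqv csu; exact: vanish_quad0.
(* [c ^ y + y ^ lin b cs' = (c - lin b cs') ^ y] is the first Darboux pair. *)
pose x u := c u - lin (B 0%N) cs' u.
have xl : linform x by move=> a u v; rewrite /x cl (lin_form _ csl'); ring.
have [||xs [k [xsl xsz eqvx kn quadE']]] := IH cs' (x :: y :: r) (fun i => B i.+1).
- by rewrite -ltnS -sz' ltnW.
- have [_ inj' dimE] := fr'; split; last by rewrite -dimE /= !size_cat /= !addnS.
    by apply/all_form_cat.
  move=> u /vanish_cat[csu [xu [yu ru]]]; apply: inj'; split=> //.
  apply/vanish_cat; split=> //; split=> //.
  by move: xu; rewrite /x vanish_lin0 // subr0.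
exists [:: x, y & xs], k.+1; split=> //=.
- by rewrite xsz sz'.
- move=> u; rewrite eqvx -eqv; split=> [[xu [yu csu]]|[cu [yu csu]]].
    by split=> //; move: xu; rewrite /x vanish_lin0 // subr0.
  by split=> //; rewrite /x cu vanish_lin0 // subr0.
- by move=> u v; rewrite quadE /= quadE' /x -/y; ring.
Qed.
End Darboux.

(** * Abelian quotients [L / z] and dimensions at most 5 *)

Section LastSteps.
Variables (F : fieldType) (L : lieVectType F) (z : L).
Hypothesis wit : witness z.
Implicit Types (c f g : L -> F) (cs r : seq (L -> F)).
Local Notation listed6 := (listed6 L).


(** All forms of [cs] are closed, and so are their linear combinations; hence [d c] can be brought
    to Darboux form freely. *)
Lemma adapted_darboux cs c : adapted z cs c ->
    (forall u v, vanish cs (lie u v)) ->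
  exists xs k, [/\ adapted z xs c, size xs = size cs,
    forall u v, vanish xs (lie u v), (k.*2 <= size xs)%N &
    forall u v, c (lie u v) = darboux k xs u v].
Proof.
move=> ad csd; have [fr _ _] := ad; have [A dc] := adapted_expand ad wit.
rewrite -cats1 in fr.
have [xs [k [xsl sz eqv kn quadE]]] := darboux_normal_form A fr.
exists xs, k; split=> //; first exact: adapted_equiv eqv.
  by move=> u v; apply/eqv.
by move=> u v; rewrite dc.
Qed.

Lemma abelian5_case cs c : adapted z cs c -> size cs = 5%N ->
  (forall u v, vanish cs (lie u v)) -> lie_isomorphic L (L6_4 F).
Proof.
move=> ad sz csd; have [xs [k [{}ad xsz xsd kn dc]]] := adapted_darboux ad csd.
move: xsz; rewrite {}sz; move: xs ad xsd kn dc.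
move=> [|x1 [|x2 [|x3 [|x4 [|x5 [|? ?]]]]]] // ad xsd kn dc _.
have d1 u v : x1 (lie u v) = 0 by case: (xsd u v).
have d2 u v : x2 (lie u v) = 0 by case: (xsd u v) => _ [].
have d3 u v : x3 (lie u v) = 0 by case: (xsd u v) => _ [_ []].
have d4 u v : x4 (lie u v) = 0 by case: (xsd u v) => _ [_ [_ []]].
have d5 u v : x5 (lie u v) = 0 by case: (xsd u v) => _ [_ [_ [_ []]]].
move: k kn dc => [|[|[|k]]] //= _ dc.
(* With at most one Darboux pair [x1 ^ d c = 0], and 0 is a primitive. *)
- by exfalso; apply: (no_witness_by_first wit (rows := [::]) ad); closed_tac.
- by exfalso; apply: (no_witness_by_first wit (rows := [::]) ad); closed_tac.
have [fr _ _] := ad; have [[l1 [l2 [l3 [l4 [l5 [l6 _]]]]]] _ _] := fr.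
apply: (@L6_4_iso _ _ x1 x2 x3 x4 c x5) => //; last by move=> u v; rewrite dc; ring.
by apply: (frame_equiv fr) => //; vanish_tac.
Qed.

Lemma abelian4_case cs c : adapted z cs c -> size cs = 4%N ->
  (forall u v, vanish cs (lie u v)) -> lie_isomorphic L (L5_4 F).
Proof.
move=> ad sz csd; have [xs [k [{}ad xsz xsd kn dc]]] := adapted_darboux ad csd.
move: xsz; rewrite {}sz; move: xs ad xsd kn dc.
move=> [|x1 [|x2 [|x3 [|x4 [|? ?]]]]] // ad xsd kn dc _.
have d1 u v : x1 (lie u v) = 0 by case: (xsd u v).
have d2 u v : x2 (lie u v) = 0 by case: (xsd u v) => _ [].
have d3 u v : x3 (lie u v) = 0 by case: (xsd u v) => _ [_ []].
have d4 u v : x4 (lie u v) = 0 by case: (xsd u v) => _ [_ [_ []]].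
move: k kn dc => [|[|[|k]]] //= _ dc.
- by exfalso; apply: (no_witness_by_first wit (rows := [::]) ad); closed_tac.
- by exfalso; apply: (no_witness_by_first wit (rows := [::]) ad); closed_tac.
have [fr _ _] := ad.
apply: (@table_iso _ _ _ (LieTable (@heisenberg_jacobi F 2)) _ fr) => //.
by move=> [|[|[|[|[|[|k]]]]]] u v //= _; diff_rewrite; ring.
Qed.

(** Two rounds: the partner [f] of [c4] in [d c5] has exact product with [d c5], hence is 0; after
    that [c1 ^ d c5] is exact too. *)
Lemma no_witness_heisenberg1_dim5 c1 c2 c3 c4 c5 : adapted z [:: c1; c2; c3; c4] c5 ->
    (forall u v, c1 (lie u v) = 0) -> (forall u v, c2 (lie u v) = 0) ->
    (forall u v, c3 (lie u v) = 0) ->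
    (forall u v, c4 (lie u v) = wedge c1 c2 u v) -> False.
Proof.
move=> ad d1 d2 d3 d4.
have [a12 [a13 [a14 [a23 [a24 [a34 d5]]]]]] := adapted_expand4 wit ad.
have [[[l1 [l2 [l3 [l4 [l5 _]]]]] _ _] [z1 [z2 _]] _] := ad.
have [e [/(_ c5 l5) J [E1 E2 E3 E4]]] := adapted_jacobi4 ad.
have Z34 : a34 = 0 by coef_tac (J 1 0 2)%N.
subst a34.
pose f u := a14 * c1 u + a24 * c2 u.
have fl : linform f by rewrite /f; lin_tac.
have fz : f z = 0 by rewrite /f z1 z2; ring.
have {}J := witness_form_eq0 ad wit fl fz
  (A := tab [:: [::]; [::]; [:: - (a14 * a23 - a24 * a13)]]).
have f0 x : f x = 0 by apply: J; rewrite /f; closed_tac.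
have Z14 : a14 = 0 by rewrite -(f0 (e 0%N)) /f; dual_rewrite; ring.
have Z24 : a24 = 0 by rewrite -(f0 (e 1%N)) /f; dual_rewrite; ring.
subst a14 a24.
apply: (no_witness_by_first wit (rows := [:: [::]; [::]; [:: - a23]]) ad).
by closed_tac.
Qed.

Lemma no_witness_filiform_dim5 c1 c2 c3 c4 c5 : adapted z [:: c1; c2; c3; c4] c5 ->
    (forall u v, c1 (lie u v) = 0) -> (forall u v, c2 (lie u v) = 0) ->
    (forall u v, c3 (lie u v) = wedge c1 c2 u v) ->
    (forall u v, c4 (lie u v) = wedge c1 c3 u v) -> False.
Proof.
move=> ad d1 d2 d3 d4.
have [a12 [a13 [a14 [a23 [a24 [a34 d5]]]]]] := adapted_expand4 wit ad.
have [[[_ [_ [_ [_ [l5 _]]]]] _ _] _ _] := ad.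
have [e [/(_ c5 l5) J [E1 E2 E3 E4]]] := adapted_jacobi4 ad.
have Z24 : a24 = 0 by coef_tac (J 0 1 2)%N.
have Z34 : a34 = 0 by coef_tac (J 0 1 3)%N.
subst a24 a34.
apply: (no_witness_by_first wit (rows := [:: [::]; [:: 0; a23]; [::]]) ad).
by closed_tac.
Qed.

(** The factor [a] treats the abelian and the Heisenberg quotient together. There are again two
    rounds, with [f] the partner of [c3], and both products with [d c4] are 0. *)
Lemma no_witness_dim4 a c1 c2 c3 c4 : adapted z [:: c1; c2; c3] c4 ->
    (forall u v, c1 (lie u v) = 0) -> (forall u v, c2 (lie u v) = 0) ->
    (forall u v, c3 (lie u v) = a * wedge c1 c2 u v) -> False.
Proof.
move=> ad d1 d2 d3; have [A /= d4] := adapted_expand ad wit.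
have [[[l1 [l2 _]] _ _] [z1 [z2 _]] _] := ad.
have [e E] := adapted_dual ad.
have E1 j : (j < 3)%N -> c1 (e j) = (0 == j)%N%:R := E 0%N j isT.
have E2 j : (j < 3)%N -> c2 (e j) = (1 == j)%N%:R := E 1%N j isT.
pose f u := A 0%N 1%N * c1 u + A 1%N 0%N * c2 u.
have fl : linform f by rewrite /f; lin_tac.
have fz : f z = 0 by rewrite /f z1 z2; ring.
have J := witness_form_eq0 ad wit fl fz (A := tab [::]).
have f0 x : f x = 0 by apply: J; rewrite /f; closed_tac.
have Z13 : A 0%N 1%N = 0 by rewrite -(f0 (e 0%N)) /f; dual_rewrite; ring.
have Z23 : A 1%N 0%N = 0 by rewrite -(f0 (e 1%N)) /f; dual_rewrite; ring.
rewrite Z13 Z23 in d4.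
by apply: (no_witness_by_first wit (rows := [::]) ad); closed_tac.
Qed.

Lemma no_witness_dim3 c1 c2 c3 : adapted z [:: c1; c2] c3 ->
  (forall u v, c1 (lie u v) = 0) -> (forall u v, c2 (lie u v) = 0) -> False.
Proof.
move=> ad d1 d2; have [A /= d3] := adapted_expand ad wit.
by apply: (no_witness_by_first wit (rows := [::]) ad); closed_tac.
Qed.

Lemma no_witness_dim2 c1 c2 : adapted z [:: c1] c2 ->
  (forall u v, c1 (lie u v) = 0) -> False.
Proof.
move=> ad d1; have [A /= d2] := adapted_expand ad wit.
by apply: (no_witness_by_first wit (rows := [::]) ad); closed_tac.
Qed.

Lemma dim1_case c : adapted z [::] c -> lie_isomorphic L (abelian_lie F 1).
Proof.
move=> ad; have [fr _ _] := ad; have [A /= dc] := adapted_expand ad wit.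
apply: (@table_iso _ _ _ (LieTable (@abelian_jacobi F 1)) _ fr) => //.
by move=> [|[|k]] u v //= _; rewrite dc.
Qed.

(** * Dimension 6: normalization of the fifth coordinate *)

Lemma lie_expand4 r c1 c2 c3 c4 c : frame [:: c1, c2, c3, c4 & r] -> linform c ->
    (forall u v, vanish [:: c1; c2; c3; c4] u -> c (lie u v) = 0) ->
  exists a12 a13 a14 a23 a24 a34, forall u v, c (lie u v) =
    a12 * wedge c1 c2 u v + a13 * wedge c1 c3 u v + a14 * wedge c1 c4 u v
    + a23 * wedge c2 c3 u v + a24 * wedge c2 c4 u v + a34 * wedge c3 c4 u v.
Proof.
move=> fr cl c0; have [[l1 [l2 [l3 [l4 _]]]] _ _] := fr.
have [||A dc] := @lie_expand _ _ [:: c1; c2; c3; c4] c _ _ cl c0.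
- by [].
- exact: (@frame_cat_free _ _ [:: c1; c2; c3; c4] r).
exists (A 0 0)%N, (A 0 1)%N, (A 0 2)%N, (A 1 0)%N, (A 1 1)%N, (A 2 0)%N.
by move=> u v; rewrite dc /=; ring.
Qed.

(** The Jacobi identity removes [c3 ^ c4] from [d c5]. If [c4] has a partner there, no witness
    exists; if only [c3] has one, the pencil case arises; if neither has, [c5 - a12 c4] is closed
    and [L / z] is [H(1) + A(2)]. *)
Lemma heisenberg1_step c1 c2 c3 c4 c5 c6 : (2 : F) != 0 ->
    adapted z [:: c1; c2; c3; c4; c5] c6 ->
    (forall u v, c1 (lie u v) = 0) -> (forall u v, c2 (lie u v) = 0) ->
    (forall u v, c3 (lie u v) = 0) ->
    (forall u v, c4 (lie u v) = wedge c1 c2 u v) ->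
    (forall u v, vanish [:: c1; c2; c3; c4] u -> c5 (lie u v) = 0) -> listed6.
Proof.
move=> two ad d1 d2 d3 d4 c50.
have [fr _ _] := ad; have [[l1 [l2 [l3 [l4 [l5 [l6 _]]]]]] _ _] := fr.
have [a12 [a13 [a14 [a23 [a24 [a34 d5]]]]]] := lie_expand4 fr l5 c50.
have [e [/(_ c5 l5) J [E1 E2 E3 E4 E5]]] := adapted_jacobi5 ad.
have Z34 : a34 = 0 by coef_tac (J 1 0 2)%N.
subst a34; clear J E1 E2 E3 E4 E5 c50.
case: (eqVneq a14 0) => [Z14|a14n]; last first.
  exfalso; apply: (@no_witness_L5_5 _ _ _ wit (a23 * a14 - a13 * a24)
    (fun u => a14 * c1 u + a24 * c2 u) (fun u => c2 u / a14) c3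
    (fun u => c4 u + a13 / a14 * c3 u) (fun u => c5 u - a12 * c4 u) c6).
  - apply: (adapted_equiv ad) => //; first by forms_tac.
    by vanish_tac.
  - by diff_tac.
  - by diff_tac.
  - by diff_tac.
  - by diff_tac.
  - by diff_tac.
subst a14; case: (eqVneq a24 0) => [Z24|a24n]; last first.
  exfalso; apply: (@no_witness_L5_5 _ _ _ wit (- a13 * a24)
    (fun u => a24 * c2 u) (fun u => - c1 u / a24) c3
    (fun u => c4 u + a23 / a24 * c3 u) (fun u => c5 u - a12 * c4 u) c6).
  - apply: (adapted_equiv ad) => //; first by forms_tac.
    by vanish_tac.
  - by diff_tac.
  - by diff_tac.
  - by diff_tac.
  - by diff_tac.
  - by diff_tac.
subst a24; case: (eqVneq a13 0) => [Z13|a13n]; last first.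
  apply: (@pencil_case _ _ _ wit
    (fun u => a13 * c1 u + a23 * c2 u) (fun u => c2 u / a13) c3
    c4 (fun u => c5 u - a12 * c4 u) c6) => //.
  - apply: (adapted_equiv ad) => //; first by forms_tac.
    by vanish_tac.
  - by diff_tac.
  - by diff_tac.
  - by diff_tac.
  - by diff_tac.
subst a13; case: (eqVneq a23 0) => [Z23|a23n]; last first.
  apply: (@pencil_case _ _ _ wit
    (fun u => a23 * c2 u) (fun u => - c1 u / a23) c3
    c4 (fun u => c5 u - a12 * c4 u) c6) => //.
  - apply: (adapted_equiv ad) => //; first by forms_tac.
    by vanish_tac.
  - by diff_tac.
  - by diff_tac.
  - by diff_tac.
  - by diff_tac.
subst a23.
apply: (@heisenberg1_case _ _ _ wit c1 c2 c3 (fun u => c5 u - a12 * c4 u) c4 c6)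
  => //; last by diff_tac.
apply: (adapted_equiv ad) => //; first by forms_tac.
by vanish_tac.
Qed.

Lemma filiform_step c1 c2 c3 c4 c5 c6 : (2 : F) != 0 ->
    adapted z [:: c1; c2; c3; c4; c5] c6 ->
    (forall u v, c1 (lie u v) = 0) -> (forall u v, c2 (lie u v) = 0) ->
    (forall u v, c3 (lie u v) = wedge c1 c2 u v) ->
    (forall u v, c4 (lie u v) = wedge c1 c3 u v) ->
    (forall u v, vanish [:: c1; c2; c3; c4] u -> c5 (lie u v) = 0) -> listed6.
Proof.
move=> two ad d1 d2 d3 d4 c50.
have [fr _ _] := ad; have [[l1 [l2 [l3 [l4 [l5 [l6 _]]]]]] _ _] := fr.
have [a12 [a13 [a14 [a23 [a24 [a34 d5]]]]]] := lie_expand4 fr l5 c50.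
have [e [/(_ c5 l5) J [E1 E2 E3 E4 E5]]] := adapted_jacobi5 ad.
have Z24 : a24 = 0 by coef_tac (J 0 1 2)%N.
have Z34 : a34 = 0 by coef_tac (J 0 1 3)%N.
subst a24 a34; clear J E1 E2 E3 E4 E5 c50.
case: (eqVneq a14 0) => [Z14|a14n].
  subst a14; exfalso; case: (eqVneq a23 0) => [Z23|a23n].
    subst a23; apply: (@no_witness_L5_5 _ _ _ wit 0 c1 c2
      (fun u => c5 u - a12 * c3 u - a13 * c4 u) c3 c4 c6) => //.
    - apply: (adapted_equiv ad) => //; first by forms_tac.
      by vanish_tac.
    - by diff_tac.
    - by diff_tac.
  apply: (@no_witness_L5_9 _ _ _ wit c1 c2 c3 c4
    (fun u => (c5 u - a12 * c3 u - a13 * c4 u) / a23) c6) => //.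
    apply: (adapted_equiv ad) => //; first by forms_tac.
    by vanish_tac.
  by diff_tac.
case: (eqVneq a23 0) => [Z23|a23n].
  subst a23; apply: (@filiform_case _ _ _ wit 0 c1 c2 c3 c4
    (fun u => (c5 u - a12 * c3 u - a13 * c4 u) / a14) c6) => //.
  - apply: (adapted_equiv ad) => //; first by forms_tac.
    by vanish_tac.
  - by diff_tac.
  - by left.
have bn : a23 / a14 != 0 by rewrite mulf_neq0 // invr_neq0.
(* After division by [a14] the coefficient of [c2 ^ c3] is [a23 / a14]; scaling all forms but [c1]
   by this number turns it into 1. *)
apply: (@filiform_case _ _ _ wit 1 c1 (fun u => a23 / a14 * c2 u)
  (fun u => a23 / a14 * c3 u) (fun u => a23 / a14 * c4 u)
  (fun u => (a23 / a14) * ((c5 u - a12 * c3 u - a13 * c4 u) / a14)) c6) => //.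
- apply: (adapted_equiv ad) => //; first by forms_tac.
  by vanish_tac.
- by diff_tac.
- by diff_tac.
- by diff_tac.
- by diff_tac.
- by right.
Qed.

(** The number of Darboux pairs of [d c5] decides: [L / z] is abelian, [H(1) + A(2)] or [H(2)]. *)
Lemma abelian4_step c1 c2 c3 c4 c5 c6 : (2 : F) != 0 ->
    adapted z [:: c1; c2; c3; c4; c5] c6 ->
    (forall u v, vanish [:: c1; c2; c3; c4] (lie u v)) ->
    (forall u v, vanish [:: c1; c2; c3; c4] u -> c5 (lie u v) = 0) -> listed6.
Proof.
move=> two ad csd c50; have [fr _ _] := ad.
have [[l1 [l2 [l3 [l4 [l5 [l6 _]]]]]] _ _] := fr.
have frcat : frame ([:: c1; c2; c3; c4] ++ [:: c5; c6]) by [].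
have [||A dc] := @lie_expand _ _ [:: c1; c2; c3; c4] c5 _ _ l5 c50.
- by [].
- exact: frame_cat_free frcat.
have [xs [k [xsl xsz eqv kn quadE]]] := darboux_normal_form A frcat.
move: xs xsl xsz eqv kn quadE.
move=> [|x1 [|x2 [|x3 [|x4 [|? ?]]]]] //= xsl _ eqv kn quadE.
have xsd u v := (eqv (lie u v)).2 (csd u v).
have d1 u v : x1 (lie u v) = 0 by case: (xsd u v).
have d2 u v : x2 (lie u v) = 0 by case: (xsd u v) => _ [].
have d3 u v : x3 (lie u v) = 0 by case: (xsd u v) => _ [_ []].
have d4 u v : x4 (lie u v) = 0 by case: (xsd u v) => _ [_ [_ []]].
have adX : adapted z [:: x1; x2; x3; x4; c5] c6.
  apply: (adapted_equiv ad) => //=; first by tauto.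
  by move=> u; have := eqv u; tauto.
have d5 u v : c5 (lie u v) = darboux k [:: x1; x2; x3; x4] u v by rewrite dc; exact: quadE.
move: k kn quadE d5 => [|[|[|k]]] //= _ _ d5.
- by left; apply: (abelian5_case adX) => // u v; do !split.
- by apply: (heisenberg1_case wit adX) => // u v; rewrite d5; ring.
- by exfalso; apply: (no_witness_heisenberg2 wit adX) => // u v; rewrite d5; ring.
Qed.
End LastSteps.

(** * Normalization of the coordinates *)

Section FirstSteps.
Variables (F : fieldType) (L : lieVectType F).
Implicit Types (c f g : L -> F) (cs r : seq (L -> F)).

Lemma flag_start c1 c2 c3 r :
    frame [:: c1, c2, c3 & r] -> flag [:: c3; c2; c1] ->
  exists a, [/\ forall u v, c1 (lie u v) = 0, forall u v, c2 (lie u v) = 0 &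
    forall u v, c3 (lie u v) = a * wedge c1 c2 u v].
Proof.
move=> fr [f3 [f2 [f1 _]]]; have [[l1 [l2 [l3 _]]] _ _] := fr.
have [|||A2 /= d2] := @lie_expand _ _ [:: c1] c2 _ _ l2.
- by [].
- exact: (@frame_cat_free _ _ [:: c1] [:: c2, c3 & r]).
- by move=> u v [u1 _]; apply: f2.
have [|||A3 /= d3] := @lie_expand _ _ [:: c1; c2] c3 _ _ l3.
- by [].
- exact: (@frame_cat_free _ _ [:: c1; c2] (c3 :: r)).
- by move=> u v [u1 [u2 _]]; apply: f3.
exists (A3 0%N 0%N); split=> u v; first exact: f1.
  by rewrite d2; ring.
by rewrite d3; ring.
Qed.

(** The alternatives are the nilpotent algebras of dimension 4: abelian, [H(1) + A(1)] and filiform.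
    For [a != 0] the partner [q c1 + s c2] of [c3] in [d c4] separates the last two. *)
Lemma flag4_cases c1 c2 c3 c4 r :
    frame [:: c1, c2, c3, c4 & r] -> flag [:: c4; c3; c2; c1] ->
  exists x1 x2 x3 x4, [/\ all_form [:: x1; x2; x3; x4],
    forall u, vanish [:: x1; x2; x3; x4] u <-> vanish [:: c1; c2; c3; c4] u &
    [\/ forall u v, vanish [:: x1; x2; x3; x4] (lie u v),
        (forall u v, vanish [:: x1; x2; x3] (lie u v)) /\
          (forall u v, x4 (lie u v) = wedge x1 x2 u v) |
        (forall u v, vanish [:: x1; x2] (lie u v)) /\
          ((forall u v, x3 (lie u v) = wedge x1 x2 u v) /\
           (forall u v, x4 (lie u v) = wedge x1 x3 u v))]].
Proof.
move=> fr [f4 fl3]; have [a [d1 d2 d3]] := flag_start fr fl3.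
have [[l1 [l2 [l3 [l4 _]]]] _ _] := fr.
have frcat : frame ([:: c1; c2; c3] ++ c4 :: r) by [].
have [|||A d4] := @lie_expand _ _ [:: c1; c2; c3] c4 _ _ l4.
- by [].
- exact: frame_cat_free frcat.
- by move=> u v [u1 [u2 [u3 _]]]; apply: f4.
case: (eqVneq a 0) => [a0|an].
  have [xs [k [xsl xsz eqv kn quadE]]] := darboux_normal_form A frcat.
  move: xs xsl xsz eqv kn quadE.
  move=> [|x1 [|x2 [|x3 [|? ?]]]] //= [k1 [k2 [k3 _]]] _ eqv kn quadE.
  have [xd1 xd2 xd3] : [/\ forall u v, x1 (lie u v) = 0,
      forall u v, x2 (lie u v) = 0 & forall u v, x3 (lie u v) = 0].
    have xd u v : vanish [:: x1; x2; x3] (lie u v).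
      by apply/eqv; do !split; rewrite ?(d1, d2, d3) // a0 mul0r.
    by split=> u v; have [? [? []]] := xd u v.
  have dc u v : c4 (lie u v) = darboux k [:: x1; x2; x3] u v.
    by rewrite d4; exact: quadE.
  exists x1, x2, x3, c4; split=> //; first by move=> u; have := eqv u; tauto.
  move: k kn quadE dc => [|[|k]] //= _ _ dc.
    by constructor 1 => u v; do !split.
  constructor 2; split=> u v; first by do !split.
  by rewrite dc; ring.
move: d4; set p := A 0%N 0%N; set q := A 0%N 1%N; set s := A 1%N 0%N => d4.
have {}d4 u v : c4 (lie u v) =
    p * wedge c1 c2 u v + q * wedge c1 c3 u v + s * wedge c2 c3 u v.
  by rewrite d4 /= -/p -/q -/s; ring.
move: p q s d4 => p q s d4 {A f4 fl3}.
case: (eqVneq q 0) => [q0|qn]; last first.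
  exists (fun u => q * c1 u + s * c2 u), (fun u => c2 u / q),
    (fun u => c3 u / a), (fun u => (c4 u - p / a * c3 u) / a).
  split; [by forms_tac | by vanish_tac |].
  by constructor 3; split; [|split] => u v; rewrite /=; do ?split; diff_tac.
case: (eqVneq s 0) => [s0|sn]; last first.
  exists (fun u => s * c2 u), (fun u => - c1 u / s),
    (fun u => c3 u / a), (fun u => (c4 u - p / a * c3 u) / a).
  split; [by forms_tac | by vanish_tac |].
  by subst q; constructor 3; split; [|split] => u v; rewrite /=; do ?split; diff_tac.
(* Here [c4 - (p / a) c3] is closed and becomes the third form. *)
exists c1, c2, (fun u => c4 u - p / a * c3 u), (fun u => c3 u / a).
subst q s; split; [by forms_tac | by vanish_tac |].
by constructor 2; split=> u v; rewrite /=; do ?split; diff_tac.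
Qed.
End FirstSteps.

(** * The classification by dimension *)

Lemma noncapable_listed (F : fieldType) (L : lieVectType F) :
    (2 : F) != 0 -> lie_nilpotent L -> (\dim {:L} <= 6)%N -> ~ capable L ->
  lie_isomorphic L (abelian_lie F 1) \/ lie_isomorphic L (L5_4 F) \/ listed6 L.
Proof.
move=> two nilL dimL /noncapable_witness[z [z0 wit]].
have [r [c [rf ad]]] := flag_exists nilL z0 (proj1 wit).
have : (size r <= 5)%N.
  by have [[_ _ sz] _ _] := ad; move: dimL; rewrite -sz size_rcons size_rev ltnS.
have [fr _ _] := ad.
move: r rf ad fr => [|c1 [|c2 [|c3 [|c4 [|c5 [|? ?]]]]]] //; rewrite /rev /=.
- by move=> _ ad _ _; left; exact: (dim1_case wit ad).
- by move=> [f1 _] ad; case: (no_witness_dim2 wit ad) => u v; exact: f1.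
- move=> [f2 [f1 _]] ad fr; case: (no_witness_dim3 wit ad) => u v; first exact: f1.
  have [[l1 [l2 _]] _ _] := fr.
  (* The flag lists the last form first: [c2] precedes [c1], and [d c1] is a 2-form in [c2] alone,
     hence 0. *)
  have [|||A /= ->] := @lie_expand _ _ [:: c2] c1 _ _ l2; [by []| | |ring].
    exact: (@frame_cat_free _ _ [:: c2] [:: c1; c]).
  by move=> x y [x1 _]; apply: f2.
- move=> rf ad fr _; have [a [d1 d2 d3]] := flag_start fr rf.
  by case: (no_witness_dim4 wit ad d1 d2 d3).
- move=> rf ad fr _.
  have [x1 [x2 [x3 [x4 [xl eqv cases]]]]] := flag4_cases fr rf.
  have {}ad := adapted_equiv ad xl erefl eqv.
  case: cases => [xd|[xd d4]|[xd [d3 d4]]].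
  + by right; left; exact: (abelian4_case wit ad).
  + by case: (no_witness_heisenberg1_dim5 wit ad _ _ _ d4) => u v;
      have [? [? []]] := xd u v.
  + by case: (no_witness_filiform_dim5 wit ad _ _ d3 d4) => u v;
      have [? []] := xd u v.
- move=> [f5 rf] ad fr _; right; right.
  have [x1 [x2 [x3 [x4 [xl eqv cases]]]]] := flag4_cases fr rf.
  have [[l1 [l2 [l3 [l4 [l5 _]]]]] _ _] := fr.
  (* The head [c1] of the flag is the last coordinate of [L / z]; only the four before it have been
     replaced. *)
  have {}ad : adapted z [:: x1; x2; x3; x4; c1] c.
    apply: (adapted_equiv ad) => //=; first by move: xl => /=; tauto.
    by move=> u; have /= := eqv u; tauto.
  have f5x u v : vanish [:: x1; x2; x3; x4] u -> c1 (lie u v) = 0.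
    by move=> /eqv /= ux; apply: f5 => /=; tauto.
  case: cases => [xd|[xd d4]|[xd [d3 d4]]].
  + exact: (abelian4_step wit two ad).
  + by apply: (heisenberg1_step wit two ad _ _ _ d4 f5x) => u v;
      have [? [? []]] := xd u v.
  + by apply: (filiform_step wit two ad _ _ d3 d4 f5x) => u v;
      have [? []] := xd u v.
Qed.

Theorem theorem1p1 (F : fieldType) (charF : 2%N \notin [pchar F])
    (L : lieVectType F) (nilL : lie_nilpotent L)
    (dimL : (\dim {:L} <= 6)%N) :
  ~ capable L <->
  lie_isomorphic L (abelian_lie F 1) \/
  lie_isomorphic L (L5_4 F) \/
  lie_isomorphic L (L6_4 F) \/
  lie_isomorphic L (L6_10 F) \/
  lie_isomorphic L (L6_14 F) \/
  lie_isomorphic L (L6_16 F) \/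
  (exists eps : F, lie_isomorphic L (L6_19 eps)) \/
  lie_isomorphic L (L6_20 F).
Proof.
have two := two_neq0 charF.
split; first exact: noncapable_listed.
case=> [|[|[|[|[|[|[[eps]|]]]]]]]; apply: noncapable_of_cocycles.
- exact: (@basisx_neq0 F 1 1).
- exact: abelian_lie1_cocycle.
- exact: (@basisx_neq0 F 5 5).
- exact: L5_4_cocycle.
- apply/eqP => /pair_equal_spec[z0 _].
  by move/eqP: (@basisx_neq0 F 5 5 isT); apply; exact: z0.
- exact: L6_4_cocycle.
- exact: (@basisx_neq0 F 6 6).
- exact: L6_10_cocycle.
- exact: (@basisx_neq0 F 6 6).
- by move=> V B; exact: L6_14_cocycle.
- exact: (@basisx_neq0 F 6 6).
- by move=> V B; exact: L6_16_cocycle.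
- exact: (@basisx_neq0 F 6 6).
- exact: L6_19_cocycle.
- exact: (@basisx_neq0 F 6 6).
- exact: L6_20_cocycle.
Qed.
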